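(* Let $n\ge 1$ be an integer. There is a unique homogeneous quasimorphism $\mu:\widetilde{\mathrm{Sp}}(2n)\to\mathbb{R}$ on the universal cover $\widetilde{\mathrm{Sp}}(2n)$ of the symplectic linear group $\mathrm{Sp}(2n)$ that descends to the determinant homomorphism on $\mathrm{U}(n)$ in the following sense: for every $[\Psi]\in\widetilde{\mathrm{Sp}}(2n)$ with $\Psi(1)\in\mathrm{Sp}(2n)\cap\mathrm{O}(2n)\cong\mathrm{U}(n)$, one has $$\det(X+iY)=\exp\left(2\pi i\,\mu([\Psi])\right),\qquad\text{where}\quad \begin{pmatrix} X & -Y\\ Y & X\end{pmatrix}:=\Psi(1)$$ with $X,Y\in\mathbb{R}^{n\times n}$.
   Context: A quasimorphism on a group $G$ is a map $\rho:G\to\mathbb{R}$ for which there is a constant $C$ such that $|\rho(gh)-\rho(g)-\rho(h)|\le C$ for all $g,h\in G$. It is called homogeneous if $\rho(g^k)=k\rho(g)$ for every $g\in G$ and every integer $k\ge 0$. The symplectic linear group is $$\mathrm{Sp}(2n):=\{\Psi\in\mathbb{R}^{2n\times 2n}\mid \Psi J_0\Psi^T=J_0\},\qquad J_0:=\begin{pmatrix}0&-\mathbb{1}\\ \mathbb{1}&0\end{pmatrix},$$ where $\mathbb{1}$ denotes the identity matrix (here of size $n\times n$). Its universal cover $\widetilde{\mathrm{Sp}}(2n)$ is viewed as the group of homotopy classes $[\Psi]$ (with fixed endpoints) of smooth paths $\Psi:[0,1]\to\mathrm{Sp}(2n)$ satisfying $\Psi(0)=\mathbb{1}$, with group operation induced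 by pointwise multiplication of paths; the covering projection is $[\Psi]\mapsto\Psi(1)$. The elements of $\mathrm{Sp}(2n)\cap\mathrm{O}(2n)$ are exactly the matrices of the form $\begin{pmatrix} X & -Y \\ Y & X \end{pmatrix}$ with $X,Y\in\mathbb{R}^{n\times n}$ and $X+iY\in\mathrm{U}(n)$; the identification $\mathrm{Sp}(2n)\cap\mathrm{O}(2n)\cong\mathrm{U}(n)$ sends this matrix to $X+iY$. *)

(* Defs.v *)
From HB Require Import structures.
From mathcomp Require Import all_boot all_order all_algebra.
From mathcomp Require Import all_classical all_reals all_analysis.
From mathcomp Require Import complex lra.

Set Implicit Arguments.
Unset Strict Implicit.
Unset Printing Implicit Defensive.

Import Order.TTheory GRing.Theory Num.Theory.
Import numFieldNormedType.Exports.
Local Open Scope classical_set_scope.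
Local Open Scope ring_scope.

Section Quasimorphism.
Variables (R : realType) (G : groupType).

Definition quasimorphism (rho : G -> R) : Prop :=
  exists C : R, forall g h : G, `|rho (g * h)%g - rho g - rho h| <= C.

Definition homogeneous (rho : G -> R) : Prop :=
  forall (g : G) (k : nat), rho (g ^+ k)%g = k%:R * rho g.

End Quasimorphism.

Section ComplexExp.
Variable R : realType.

Definition cexp (z : R[i]) : R[i] :=
  (expR (complex.Re z))%:C%C * (cos (complex.Im z) +i* sin (complex.Im z))%C.

Definition complex_mx m n (X Y : 'M[R]_(m, n)) : 'M[R[i]]_(m, n) :=
  \matrix_(i, j) (X i j +i* Y i j)%C.

End ComplexExp.

Section Smooth.
Variable R : realType.

Definition smooth (V : normedModType R) (f : R -> V) : Prop :=
  forall (k : nat) (t : R), derivable (derive1n k f) t 1.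

(* Only the values on [0, 1] matter; one-sided smoothness at the endpoints is
   expressed by extension to the line. *)
Definition smooth_on01 (V : normedModType R) (f : R -> V) : Prop :=
  exists F : R -> V, smooth F /\ {in `[0, 1], f =1 F}.

Fixpoint Ck (V : normedModType R) (k : nat) (f : R -> V) : Prop :=
  if k is k'.+1 then (forall t, derivable f t 1) /\ Ck k' (derive1 f)
  else forall t, derivable f t 1.

Lemma CkS (V : normedModType R) k (f : R -> V) : Ck k.+1 f -> Ck k f.
Proof. by elim: k f => [|k IH] f [df /= Cf] //; split=> //; exact: IH. Qed.

Lemma Ck_smooth (V : normedModType R) (f : R -> V) :
  smooth f <-> forall k, Ck k f.
Proof.
split=> [sf k|Cf k].
  elim: k f sf => [|k IH] f sf; first exact: (sf 0%N).
  split; first exact: (sf 0%N).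
  by apply: IH => j t; rewrite -derive1Sn; exact: sf.
elim: k f Cf => [|k IH] f Cf t; first exact: (Cf 0%N).
by rewrite derive1Sn; apply: IH => j; case: (Cf j.+1).
Qed.

Lemma Ck_cst (V : normedModType R) k (a : V) : Ck k (fun=> a : V).
Proof.
elim: k a => [|k IH] a /=; first by move=> t; exact: derivable_cst.
split; first by move=> t; exact: derivable_cst.
have -> : derive1 (fun=> a : V) = (fun=> 0 : V).
  by apply/funext => t; rewrite derive1_cst.
exact: IH.
Qed.

Lemma CkD (V : normedModType R) k (f g : R -> V) :
  Ck k f -> Ck k g -> Ck k (fun t => f t + g t).
Proof.
elim: k f g => [|k IH] f g /=.
  by move=> df dg t; exact: derivableD.
move=> [df Cf] [dg Cg]; split; first by move=> t; exact: derivableD.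
suff -> : derive1 (fun t => f t + g t) =
    (fun t => derive1 f t + derive1 g t) by exact: IH.
apply/funext => t; rewrite !derive1E.
exact: deriveD.
Qed.

Lemma CkM k (f g : R -> R) : Ck k f -> Ck k g -> Ck k (fun t => f t * g t).
Proof.
elim: k f g => [|k IH] f g.
  by move=> df dg t; exact: derivableM.
move=> Cf Cg; have [df Cf'] := Cf; have [dg Cg'] := Cg.
split; first by move=> t; exact: derivableM.
have -> : derive1 (fun t => f t * g t) =
    (fun t => f t * derive1 g t + g t * derive1 f t).
  by apply/funext => t; rewrite !derive1E; exact: deriveM.
by apply: CkD; apply: IH => //; exact: CkS.
Qed.

Lemma Ck_sum k n (f : 'I_n -> R -> R) :
  (forall i, Ck k (f i)) -> Ck k (fun t => \sum_i f i t).
Proof.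
elim: n f => [|n IH] f Cf.
  under eq_fun do rewrite big_ord0; exact: Ck_cst.
under eq_fun do rewrite big_ord_recl.
by apply: CkD => //; exact: IH.
Qed.

Let derivable_mxR m n (M : R -> 'M[R]_(m, n)) t :
  derivable M t 1 <-> forall i j, derivable (fun x => M x i j) t 1.
Proof. exact: derivable_mxP. Qed.

Lemma Ck_mxP k m n (M : R -> 'M[R]_(m, n)) :
  Ck k M <-> forall i j, Ck k (fun t => M t i j).
Proof.
elim: k M => [|k IH] M /=.
  split=> [dM i j t|dM t]; first exact: (derivable_mxR _ _).1.
  by apply/derivable_mxR => i j; exact: dM.
have E : (forall t, derivable M t 1) -> forall i j,
    derive1 (fun t => M t i j) = (fun t => derive1 M t i j).
  by move=> dM i j; apply/funext => t; rewrite !derive1E derive_mx// mxE.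
split=> [[dM CM] i j|dM].
  split; first by move=> t; exact: (derivable_mxR _ _).1.
  by rewrite E//; exact: (IH _).1.
have dM' t : derivable M t 1.
  by apply/derivable_mxR => i j; case: (dM i j).
by split=> //; apply/IH => i j; rewrite -E//; case: (dM i j).
Qed.

Lemma smooth_mulmx m n p (A : R -> 'M[R]_(m, n)) (B : R -> 'M[R]_(n, p)) :
  smooth A -> smooth B -> smooth (fun t => A t *m B t).
Proof.
move=> /Ck_smooth sA /Ck_smooth sB; apply/Ck_smooth => k.
apply/Ck_mxP => i j; under eq_fun do rewrite mxE.
by apply: Ck_sum => l; apply: CkM; apply: (Ck_mxP _ _).1.
Qed.

Lemma smooth_trmx m n (A : R -> 'M[R]_(m, n)) :
  smooth A -> smooth (fun t => (A t)^T).
Proof.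
move=> /Ck_smooth sA; apply/Ck_smooth => k.
apply/Ck_mxP => i j; under eq_fun do rewrite mxE.
exact: (Ck_mxP _ _).1.
Qed.

Lemma smooth_cst (V : normedModType R) (a : V) : smooth (fun=> a : V).
Proof. by apply/Ck_smooth => k; exact: Ck_cst. Qed.

End Smooth.

Section MatrixContinuity.
Variable R : realType.

Lemma cvg_mxP m n (T : Type) (F : set_system T) (FF : Filter F)
    (f : T -> 'M[R]_(m, n)) (a : 'M[R]_(m, n)) :
  (f x @[x --> F] --> a) <-> forall i j, f x i j @[x --> F] --> a i j.
Proof.
split=> [fa i j|fa].
  exact: (cvg_comp _ _ fa (@coord_continuous R m n i j a)).
move=> U [P aP sPU]; rewrite nbhs_filterE.
apply: (@filterS _ F _
    (\bigcap_(ij in setT) [set x | P ij.1 ij.2 (f x ij.1 ij.2)])).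
  by move=> x Px; apply: sPU => i j; exact: (Px (i, j)).
have H := @filter_forall T ('I_m * 'I_n)%type
  (fun ij x => P ij.1 ij.2 (f x ij.1 ij.2)) F FF.
apply: filterS (H _); first by move=> x Px ij _; exact: Px.
by move=> [i j]; exact: fa.
Qed.

Lemma cvg_mulmx m n p (T : Type) (F : set_system T) (FF : Filter F)
    (f : T -> 'M[R]_(m, n)) (g : T -> 'M[R]_(n, p))
    (a : 'M[R]_(m, n)) (b : 'M[R]_(n, p)) :
  f x @[x --> F] --> a -> g x @[x --> F] --> b ->
  f x *m g x @[x --> F] --> a *m b.
Proof.
move=> /cvg_mxP fa /cvg_mxP gb; apply/cvg_mxP => i j.
under eq_fun do rewrite mxE.
rewrite mxE; apply: cvg_big => [|k _]; first exact: add_continuous.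
by apply: cvgM.
Qed.

Lemma cvg_trmx m n (T : Type) (F : set_system T) (FF : Filter F)
    (f : T -> 'M[R]_(m, n)) (a : 'M[R]_(m, n)) :
  f x @[x --> F] --> a -> (f x)^T @[x --> F] --> a^T.
Proof.
move=> /cvg_mxP fa; apply/cvg_mxP => i j.
by under eq_fun do rewrite mxE; rewrite mxE; exact: fa.
Qed.

End MatrixContinuity.

Section Symplectic.
Variables (R : realType) (n : nat).
Implicit Types A B : 'M[R]_(n + n).

Definition J0 : 'M[R]_(n + n) := block_mx 0 (- 1%:M) 1%:M 0.

Definition symplectic A : Prop := A *m J0 *m A^T = J0.

Definition orthogonal_mx A : Prop := A *m A^T = 1%:M.

Definition sp_inv A : 'M[R]_(n + n) := J0 *m A^T *m J0^T.

Lemma J0_trJ0 : J0 *m J0^T = 1%:M.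
Proof.
rewrite /J0 tr_block_mx !trmx0 trmx1 mulmx_block.
rewrite !mul0mx !mulmx0 !mul1mx !add0r !addr0 linearN /= trmx1.
by rewrite mulNmx mul1mx opprK -scalar_mx_block.
Qed.

Lemma symplectic1 : symplectic 1%:M.
Proof. by rewrite /symplectic trmx1 mul1mx mulmx1. Qed.

Lemma symplecticM A B : symplectic A -> symplectic B -> symplectic (A *m B).
Proof.
rewrite /symplectic => hA hB; rewrite trmx_mul.
by rewrite -[RHS]hA -[in RHS]hB !mulmxA.
Qed.

Lemma mul_sp_inv A : symplectic A -> A *m sp_inv A = 1%:M.
Proof. by move=> hA; rewrite /sp_inv !mulmxA hA J0_trJ0. Qed.

Lemma mul_sp_invl A : symplectic A -> sp_inv A *m A = 1%:M.
Proof. by move=> hA; apply: mulmx1C; exact: mul_sp_inv. Qed.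

Lemma symplecticV A : symplectic A -> symplectic (sp_inv A).
Proof.
move=> hA; have h := mul_sp_invl hA; rewrite /symplectic -[in LHS]hA.
rewrite !mulmxA h mul1mx -mulmxA -trmx_mul h trmx1.
by rewrite mulmx1.
Qed.

Lemma sp_inv1 : sp_inv 1%:M = 1%:M.
Proof. by rewrite /sp_inv trmx1 mulmx1 J0_trJ0. Qed.

Lemma symplectic_orthogonal_block A : symplectic A -> orthogonal_mx A ->
  A = block_mx (ulsubmx A) (- dlsubmx A) (dlsubmx A) (ulsubmx A).
Proof.
move=> hA oA; have : A *m J0 = J0 *m A.
  by rewrite -[in RHS]hA -mulmxA (mulmx1C oA) mulmx1.
rewrite -{1 2}[A]submxK /J0 !mulmx_block !mulmx0 !mul0mx !mulmx1 !mul1mx.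
rewrite !add0r !addr0 !mulmxN !mulNmx !mulmx1 !mul1mx.
move=> /eq_block_mx[hb ha _ _].
by rewrite -[LHS]submxK hb (oppr_inj ha).
Qed.

End Symplectic.

Section UniversalCover.
Variables (R : realType) (n : nat).

(* A path is given by a total function of which only the restriction to [0, 1]
   is meaningful; functions with the same restriction are homotopic, hence
   define the same element of the universal cover. *)
Record sp_path := SpPath {
  sp_fun :> R -> 'M[R]_(n + n);
  sp_smooth : smooth_on01 sp_fun;
  sp_symplectic : {in `[0, 1], forall t, symplectic (sp_fun t)};
  sp_path0 : sp_fun 0 = 1%:M
}.

HB.instance Definition _ := gen_eqMixin sp_path.
HB.instance Definition _ := gen_choiceMixin sp_path.

(* The first variable is the homotopy parameter, the second one the time. *)
Definition path_homotopy (Psi Phi : sp_path)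
    (H : R * R -> 'M[R]_(n + n)) : Prop :=
  [/\ {within `[0, 1] `*` `[0, 1], continuous H},
      {in `[0, 1] &, forall s t, symplectic (H (s, t))},
      {in `[0, 1], forall t, H (0, t) = Psi t /\ H (1, t) = Phi t} &
      {in `[0, 1], forall s, H (s, 0) = 1%:M /\ H (s, 1) = Psi 1}].

Definition homotopic (Psi Phi : sp_path) : bool :=
  `[< exists H, path_homotopy Psi Phi H >].

Let I0 : (0 : R) \in `[0, 1].
Proof. by rewrite in_itv /= lexx ler01. Qed.

Let I1 : (1 : R) \in `[0, 1].
Proof. by rewrite in_itv /= lexx ler01. Qed.

Lemma path_homotopy1 Psi Phi H : path_homotopy Psi Phi H -> Psi 1 = Phi 1.
Proof.
by move=> [_ _ hE hB]; rewrite -(hB 1 I1).2 (hE 1 I1).2.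
Qed.

Let homotopy_of_eq (Psi Phi : sp_path) :
  {in `[0, 1], Psi =1 Phi} -> homotopic Psi Phi.
Proof.
move=> E; apply/asboolP; exists (fun st => Psi st.2); split.
- have [F [sF PF]] := sp_smooth Psi.
  have cF : continuous F.
    move=> t; apply: differentiable_continuous.
    by apply/derivable1_diffP; exact: (sF 0%N).
  have cF2 : continuous (F \o snd : R * R -> 'M[R]_(n + n)).
    by move=> x; apply: continuous_comp; [exact: cvg_snd | exact: cF].
  apply: (@subspace_eq_continuous _ _ _ (F \o snd)); last first.
    exact: continuous_subspaceT cF2.
  by move=> [s t]; rewrite inE => -[/= _ It]; exact/esym/PF.
- by move=> s t _ It /=; exact: sp_symplectic.
- by move=> t It; rewrite E.
- by move=> s Is; rewrite /= sp_path0.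
Qed.

Lemma homotopic_refl : reflexive homotopic.
Proof. by move=> Psi; exact: homotopy_of_eq. Qed.

Let within_comp (A B : set (R * R)) (g : R * R -> R * R)
    (H : R * R -> 'M[R]_(n + n)) :
  continuous g -> (forall x, A x -> B (g x)) ->
  {within B, continuous H} -> {within A, continuous (H \o g)}.
Proof.
move=> cg AB /subspace_continuousP cH; apply/subspace_continuousP => x Ax.
move=> U /(cH (g x) (AB x Ax)) /(cg x) /=.
by rewrite /within /= !nbhs_simpl /=; apply: filterS => y hy /AB; exact: hy.
Qed.

Let rep_continuous (a b : R) : continuous (fun x : R * R => (a * x.1 + b, x.2)).
Proof.
move=> x.
have h : a * y.1 + b @[y --> x] --> a * x.1 + b.
  apply: cvgD; last exact: cvg_cst.
  by apply: cvgM; [exact: cvg_cst | exact: cvg_fst].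
exact: (cvg_pair h (@cvg_snd _ _ (nbhs x.1) (nbhs x.2) _)).
Qed.

Lemma homotopic_sym : symmetric homotopic.
Proof.
suff W Psi Phi : homotopic Psi Phi -> homotopic Phi Psi.
  by move=> Psi Phi; apply/idP/idP; exact: W.
move=> /asboolP[H hH]; have E := path_homotopy1 hH.
have [cH sH eH bH] := hH; apply/asboolP.
have I s : s \in `[0, 1] -> -1 * s + 1 \in `[0 : R, 1].
  rewrite !in_itv /= => /andP[s0 s1].
  by apply/andP; split; lra.
exists (H \o (fun x => (-1 * x.1 + 1, x.2))); split.
- apply: within_comp cH; first exact: rep_continuous.
  by move=> [s t] [/= Is It]; split=> //=; exact: I.
- by move=> s t Is It /=; apply: sH => //; exact: I.
- move=> t It /=; rewrite mulr0 add0r mulr1 addNr.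
  by have [-> ->] := eH t It.
- by move=> s Is /=; rewrite -E; apply: bH; exact: I.
Qed.

Lemma homotopic_trans : transitive homotopic.
Proof.
move=> Phi Psi Xi /asboolP[H hH] /asboolP[K hK]; apply/asboolP.
have EH := path_homotopy1 hH; have EK := path_homotopy1 hK.
have [cH sH eH bH] := hH; have [cK sK eK bK] := hK.
have [h hh] : exists h : R, 2 * h = 1.
  by exists 2^-1; rewrite mulfV// pnatr_eq0.
have h0 : 0 < h by lra.
have h1 : h < 1 by lra.
pose gH := fun x : R * R => (2 * x.1 + 0, x.2).
pose gK := fun x : R * R => (2 * x.1 + -1, x.2).
have IH s : s \in `[0, h] -> 2 * s + 0 \in `[0 : R, 1].
  by rewrite !in_itv /= => /andP[s0 sh]; apply/andP; split; lra.
have IK s : s \in `[h, 1] -> 2 * s + -1 \in `[0 : R, 1].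
  by rewrite !in_itv /= => /andP[s0 sh]; apply/andP; split; lra.
pose L x := if x.1 <= h then H (gH x) else K (gK x).
have Isplit s : s \in `[0, 1] -> (s <= h -> s \in `[0, h]) *
    (~~ (s <= h) -> s \in `[h, 1]).
  rewrite !in_itv /= => /andP[s0 s1]; split; first by move=> ->; rewrite s0.
  by rewrite -ltNge => /ltW ->.
exists L; split.
- have -> : (`[0, 1] `*` `[0, 1])%classic =
      (`[0, h] `*` `[0, 1])%classic `|` (`[h, 1] `*` `[0, 1])%classic
      :> set (R * R).
    apply/seteqP; split=> -[s t] /=.
      move=> [Is It]; have [A B] := Isplit s Is.
      by case: (boolP (s <= h)) => hs; [left|right]; split=> //; auto.
    move=> [] [Is It]; split=> //=; move: Is; rewrite /= !in_itv /=.
      by move=> /andP[-> sh] /=; apply: (le_trans sh); exact: ltW.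
    by move=> /andP[hs ->]; rewrite andbT; apply: le_trans hs; exact: ltW.
  have cl (a b c d : R) : closed (`[a, b] `*` `[c, d])%classic.
    have -> : (`[a, b] `*` `[c, d])%classic =
        fst @^-1` `[a, b]%classic `&` snd @^-1` `[c, d]%classic by [].
    apply: closedI; apply: preimage_closed; try exact: interval_closed.
      by move=> x _; exact: cvg_fst.
    by move=> x _; exact: cvg_snd.
  apply: withinU_continuous => //.
    apply: (@subspace_eq_continuous _ _ _ (H \o gH)); last first.
      apply: within_comp cH; first exact: rep_continuous.
      by move=> [s t] [/= Is It]; split=> //=; exact: IH.
    move=> [s t]; rewrite inE => -[/= + _]; rewrite /= in_itv /= => /andP[_ sh].
    by change (H (gH (s, t)) = L (s, t)); rewrite /L /= sh.
  apply: (@subspace_eq_continuous _ _ _ (K \o gK)); last first.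
    apply: within_comp cK; first exact: rep_continuous.
    by move=> [s t] [/= Is It]; split=> //=; exact: IK.
  move=> [s t]; rewrite inE => -[/= + It]; rewrite /= in_itv /= => /andP[hs _].
  change (K (gK (s, t)) = L (s, t)); rewrite /L /=; case: ifP => // sh.
  have -> : s = h by apply/eqP; rewrite eq_le sh hs.
  rewrite /gH /gK /= hh addr0 subrr.
  by rewrite (eK t It).1 (eH t It).2.
- move=> s t Is It; have [A B] := Isplit s Is.
  rewrite /L /=; case: (boolP (s <= h)) => hs.
    by apply: sH => //; apply: IH; exact: A.
  by apply: sK => //; apply: IK; exact: B.
- move=> t It; rewrite /L /= (ltW h0) leNgt h1 /= /gH /gK /=.
  rewrite mulr0 addr0 mulr1 (_ : 2 + -1 = 1); last by lra.
  by rewrite (eH t It).1 (eK t It).2.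
- move=> s Is; have [A B] := Isplit s Is.
  rewrite /L /=; case: (boolP (s <= h)) => hs.
    by apply: bH; apply: IH; exact: A.
  by rewrite EH; apply: bK; apply: IK; exact: B.
Qed.

Canonical homotopic_equiv :=
  EquivRel homotopic homotopic_refl homotopic_sym homotopic_trans.

Let smooth_one : smooth_on01 (fun=> 1%:M : 'M[R]_(n + n)).
Proof. by exists (fun=> 1%:M); split=> //; exact: smooth_cst. Qed.

Definition path_one : sp_path :=
  SpPath smooth_one (fun t _ => symplectic1 R n) erefl.

Let smooth_mul (Psi Phi : sp_path) : smooth_on01 (fun t => Psi t *m Phi t).
Proof.
have [F [sF PF]] := sp_smooth Psi; have [G [sG PG]] := sp_smooth Phi.
exists (fun t => F t *m G t); split; first exact: smooth_mulmx.
by move=> t It; rewrite PF// PG.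
Qed.

Let symplectic_mul (Psi Phi : sp_path) :
  {in `[0, 1], forall t, symplectic (Psi t *m Phi t)}.
Proof. by move=> t It; apply: symplecticM; exact: sp_symplectic. Qed.

Let mul_path0 (Psi Phi : sp_path) : Psi 0 *m Phi 0 = 1%:M.
Proof. by rewrite (sp_path0 Psi) (sp_path0 Phi) mulmx1. Qed.

Definition path_mul (Psi Phi : sp_path) : sp_path :=
  SpPath (smooth_mul Psi Phi) (@symplectic_mul Psi Phi) (mul_path0 Psi Phi).

Let smooth_inv (Psi : sp_path) : smooth_on01 (fun t => sp_inv (Psi t)).
Proof.
have [F [sF PF]] := sp_smooth Psi.
exists (fun t => sp_inv (F t)); split; last by move=> t It; rewrite PF.
apply: smooth_mulmx; last exact: smooth_cst.
by apply: smooth_mulmx; [exact: smooth_cst | exact: smooth_trmx].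
Qed.

Let symplectic_inv (Psi : sp_path) :
  {in `[0, 1], forall t, symplectic (sp_inv (Psi t))}.
Proof. by move=> t It; apply: symplecticV; exact: sp_symplectic. Qed.

Let inv_path0 (Psi : sp_path) : sp_inv (Psi 0) = 1%:M.
Proof. by rewrite (sp_path0 Psi) sp_inv1. Qed.

Definition path_inv (Psi : sp_path) : sp_path :=
  SpPath (smooth_inv Psi) (@symplectic_inv Psi) (inv_path0 Psi).

Lemma homotopic_mul Psi Psi' Phi Phi' :
  homotopic Psi Psi' -> homotopic Phi Phi' ->
  homotopic (path_mul Psi Phi) (path_mul Psi' Phi').
Proof.
move=> /asboolP[H [cH sH eH bH]] /asboolP[K [cK sK eK bK]]; apply/asboolP.
exists (fun x => H x *m K x); split.
- move: cH cK => /subspace_continuousP cH /subspace_continuousP cK.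
  apply/subspace_continuousP => x Ix.
  by apply: cvg_mulmx; [exact: cH | exact: cK].
- by move=> s t Is It; apply: symplecticM; [exact: sH | exact: sK].
- by move=> t It /=; have [-> ->] := eH t It; have [-> ->] := eK t It.
- move=> s Is /=; have [-> ->] := bH s Is; have [-> ->] := bK s Is.
  by rewrite mulmx1.
Qed.

Lemma homotopic_inv Psi Psi' :
  homotopic Psi Psi' -> homotopic (path_inv Psi) (path_inv Psi').
Proof.
move=> /asboolP[H [cH sH eH bH]]; apply/asboolP.
exists (fun x => sp_inv (H x)); split.
- move: cH => /subspace_continuousP cH.
  apply/subspace_continuousP => x Ix.
  apply: cvg_mulmx; last exact: cvg_cst.
  by apply: cvg_mulmx; [exact: cvg_cst | apply: cvg_trmx; exact: cH].
- by move=> s t Is It; apply: symplecticV; exact: sH.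
- by move=> t It /=; have [-> ->] := eH t It.
- by move=> s Is /=; have [-> ->] := bH s Is; rewrite sp_inv1.
Qed.

Definition SpTilde := {eq_quot homotopic_equiv}%qT.

HB.instance Definition _ := Choice.on SpTilde.
HB.instance Definition _ := EqQuotient.on SpTilde.

Definition path_class (Psi : sp_path) : SpTilde := \pi_SpTilde%qT Psi.

Lemma path_classP Psi Phi :
  path_class Psi = path_class Phi <-> exists H, path_homotopy Psi Phi H.
Proof.
by split=> [/eqmodP/asboolP //|h]; apply/eqmodP/asboolP.
Qed.

Definition tilde_one : SpTilde := path_class path_one.
Definition tilde_mul (x y : SpTilde) : SpTilde :=
  path_class (path_mul (repr x) (repr y)).
Definition tilde_inv (x : SpTilde) : SpTilde :=
  path_class (path_inv (repr x)).

Lemma repr_class Psi : homotopic (repr (path_class Psi)) Psi.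
Proof. by apply/eqmodP; rewrite reprK. Qed.

Lemma path_class_mul Psi Phi :
  tilde_mul (path_class Psi) (path_class Phi) = path_class (path_mul Psi Phi).
Proof. by apply/eqmodP; apply: homotopic_mul; exact: repr_class. Qed.

Lemma path_class_inv Psi :
  tilde_inv (path_class Psi) = path_class (path_inv Psi).
Proof. by apply/eqmodP; apply: homotopic_inv; exact: repr_class. Qed.

Let classE (x : SpTilde) : exists Psi, x = path_class Psi.
Proof. by exists (repr x); rewrite /path_class reprK. Qed.

Let class_eq (Psi Phi : sp_path) :
  {in `[0, 1], Psi =1 Phi} -> path_class Psi = path_class Phi.
Proof. by move=> E; apply/eqmodP; exact: homotopy_of_eq. Qed.

Let tilde_mulA : associative tilde_mul.
Proof.
move=> x y z; have [[[a ->] [b ->]] [c ->]] := (classE x, classE y, classE z).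
by rewrite !path_class_mul; apply: class_eq => t _ /=; rewrite mulmxA.
Qed.

Let tilde_mul1 : left_id tilde_one tilde_mul.
Proof.
move=> x; have [a ->] := classE x.
by rewrite path_class_mul; apply: class_eq => t _ /=; rewrite mul1mx.
Qed.

Let tilde_mulr1 : right_id tilde_one tilde_mul.
Proof.
move=> x; have [a ->] := classE x.
by rewrite path_class_mul; apply: class_eq => t _ /=; rewrite mulmx1.
Qed.

Let tilde_mulV : left_inverse tilde_one tilde_inv tilde_mul.
Proof.
move=> x; have [a ->] := classE x.
rewrite path_class_inv path_class_mul; apply: class_eq => t It /=.
by rewrite mul_sp_invl//; exact: sp_symplectic.
Qed.

Let tilde_mulrV : right_inverse tilde_one tilde_inv tilde_mul.
Proof.
move=> x; have [a ->] := classE x.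
rewrite path_class_inv path_class_mul; apply: class_eq => t It /=.
by rewrite mul_sp_inv//; exact: sp_symplectic.
Qed.

HB.instance Definition _ := isGroup.Build SpTilde
  tilde_mulA tilde_mul1 tilde_mulr1 tilde_mulV tilde_mulrV.

Lemma path_classM (Psi Phi : sp_path) :
  path_class (path_mul Psi Phi) = (path_class Psi * path_class Phi)%g.
Proof. by rewrite -path_class_mul. Qed.

End UniversalCover.

Section Descent.
Variables (R : realType) (n : nat).

(* By symplectic_orthogonal_block, X and Y with the stated block form exist
   (and are then unique) for every symplectic orthogonal endpoint. *)
Definition descends_to_det (mu : SpTilde R n -> R) : Prop :=
  forall (Psi : sp_path R n) (X Y : 'M[R]_n),
    symplectic (Psi 1) -> orthogonal_mx (Psi 1) ->
    Psi 1 = block_mx X (- Y) Y X ->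
    \det (complex_mx X Y) =
      cexp ((2 * pi)%:C%C * 'i%C * (mu (path_class Psi))%:C%C).

End Descent.

(* Main.v *)
Require Import Defs.
From mathcomp Require Import all_boot all_order all_algebra.
From mathcomp Require Import all_classical all_reals all_analysis.
From mathcomp Require Import complex ring lra.
Set Implicit Arguments.
Unset Strict Implicit.
Unset Printing Implicit Defensive.
Import Order.TTheory GRing.Theory Num.Theory.
Import numFieldNormedType.Exports.
Local Open Scope classical_set_scope.
Local Open Scope ring_scope.

(** The idea, in two halves.

Existence. Write a symplectic matrix as [z |-> a z + b (conj z)] on complex n-space,
with [a] its complex linear and [b] its antilinear part. Invariance of the symplectic
form makes [a] invertible, so that [det a] is a continuous function into the nonzero
complex numbers which equals the complex determinant on unitary matrices. Count how
many times [det a] turns around 0 along a path ([turns]); this depends on the homotopy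
class only. For a product of two paths the complex linear part is [a a' + b conj(b')],
and deforming it through [a a' + s b conj(b')] reduces the comparison of the number of
turns with the sum of those of the factors to the endpoints ([winding_square]). There
the deformation contributes the argument of [det (1 + s M)], where the eigenvalues of
[M] have modulus less than 1 ([transfer_spectrum]): each factor [1 + s l] stays in the
right half-plane, so the error is bounded by a quarter turn per dimension. When the
second endpoint is unitary, [M] vanishes and the count is additive. Hence the
homogenization of [turns] is a homogeneous quasimorphism that agrees with [turns] on
the elements over the unitary group ([descending_quasimorphism_exists]).

Uniqueness. Let [rho] be the difference of two solutions; its values over the unitary
group are integers. A homogeneous quasimorphism is invariant under conjugation, hence
vanishes on an element conjugate to its inverse or to a proper power of itself. This
applies to curves of symmetric matrices (conjugate by [J0]) and to shears and unipotent
linear curves (conjugate by dilations). A curve whose upper left block stays positive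
is a product of a bounded number of such curves, by Gaussian elimination with smooth
pivots ([smooth_LDU]); so [rho] is bounded on all of these ([value_ulblock_pos]), in
particular on all curves close to the identity. If two unitary curves are close enough,
a large common power of them still differs by such a curve, and dividing by the exponent
shows that their values differ by less than 1 ([value_close]). Being an integer, the
value stays constant while a unitary curve is shrunk to its origin: [rho] vanishes over
the unitary group, without any knowledge of the fundamental group ([value_unitary]).
Finally every curve is a unitary one times a block triangular one of bounded value, by
a smooth Gram-Schmidt process ([value_bounded]); so [rho] is bounded, hence 0. *)

(** * Homogeneous quasimorphisms on a group *)

Section HomogeneousQuasimorphisms.
Variables (R : realType) (G : groupType).
Implicit Types (phi mu rho : G -> R) (C : R).

Lemma bounded_multiples0 (x C : R) : (forall k : nat, k%:R * `|x| <= C) -> x = 0.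
Proof.
move=> h; apply/eqP/negPn/negP => x0.
have x1 : 0 < `|x| by rewrite normr_gt0.
have := h (Num.bound (C / `|x|)); apply/negP; rewrite -ltNge -ltr_pdivrMr //.
by rewrite archi_boundP// divr_ge0//; have := h 0%N; rewrite mul0r.
Qed.

Section Facts.
Variable rho : G -> R.
Hypotheses (qrho : quasimorphism rho) (hrho : homogeneous rho).

Lemma homogeneous1 : rho 1%g = 0.
Proof. by rewrite -(expg0 1%g) hrho mul0r. Qed.

Lemma homogeneousV g : rho g^-1%g = - rho g.
Proof.
have [C hC] := qrho; apply/eqP; rewrite -addr_eq0; apply/eqP.
apply: (@bounded_multiples0 _ C) => k.
have := hC (g^-1 ^+ k)%g (g ^+ k)%g.
rewrite -expgMn; last by rewrite /commute mulVg mulgV.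
rewrite mulVg expg1n homogeneous1 !hrho sub0r -opprD -mulrDr normrN.
by rewrite normrM normr_nat.
Qed.

(** Conjugation moves the value of every power by the same bounded amount. *)
Lemma homogeneousJ g h : rho (h * g * h^-1)%g = rho g.
Proof.
have [C hC] := qrho; apply/eqP; rewrite -subr_eq0; apply/eqP.
apply: (@bounded_multiples0 _ (C + C)) => k.
have E : ((h * g * h^-1) ^+ k)%g = (h * g ^+ k * h^-1)%g.
  elim: k => [|k IH]; first by rewrite !expg0 mulg1 mulgV.
  by rewrite !expgS IH !mulgA mulgVK.
rewrite -{1}normr_nat -normrM mulrBr -!hrho E.
have := hC (h * g ^+ k)%g h^-1%g; have := hC h (g ^+ k)%g.
rewrite homogeneousV !ler_norml => /andP[? ?] /andP[? ?].
by apply/andP; split; lra.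
Qed.

(** Conjugation invariance turns the hypothesis into [rho g = k.+2 * rho g]. *)
Lemma homogeneous_conj_pow0 g h k :
  (h * g * h^-1)%g = (g ^+ k.+2)%g -> rho g = 0.
Proof.
move=> /(congr1 rho); rewrite homogeneousJ hrho -[X in X = _]mul1r => /eqP.
rewrite -subr_eq0 -mulrBl mulf_eq0 => /orP[|/eqP//].
rewrite -[k.+2]addn1 natrD opprD addrCA subrr addr0 oppr_eq0.
by rewrite pnatr_eq0.
Qed.

Lemma homogeneous_conj_inv0 g h : (h * g * h^-1)%g = g^-1%g -> rho g = 0.
Proof. by move=> /(congr1 rho); rewrite homogeneousJ homogeneousV => ?; lra. Qed.

Lemma bounded_homogeneous0 C : (forall g, `|rho g| <= C) -> forall g, rho g = 0.
Proof.
move=> hC g; apply: (@bounded_multiples0 _ C) => k.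
by rewrite -[k%:R]normr_nat -normrM -hrho.
Qed.

End Facts.

Lemma quasimorphismB rho mu : quasimorphism rho -> quasimorphism mu ->
  quasimorphism (fun g => rho g - mu g).
Proof.
move=> [C hC] [D hD]; exists (C + D) => g h.
have := hC g h; have := hD g h.
rewrite !ler_norml => /andP[? ?] /andP[? ?]; by apply/andP; split; lra.
Qed.

Lemma homogeneousB rho mu : homogeneous rho -> homogeneous mu ->
  homogeneous (fun g => rho g - mu g).
Proof. by move=> hr hm g k; rewrite hr hm mulrBr. Qed.

Lemma quasimorphism_pow phi C : (forall g h, `|phi (g * h)%g - phi g - phi h| <= C) ->
  forall g k, `|phi (g ^+ k)%g - k%:R * phi g| <= k.+1%:R * C.
Proof.
move=> hC g k; elim: k => [|k IH].
  rewrite expg0 mul0r subr0 mul1r.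
  by have := hC 1%g 1%g; rewrite mulg1 subrr sub0r normrN.
have := hC g (g ^+ k)%g; rewrite expgS.
move: IH; rewrite -[k.+2%:R]natr1 -![k.+1%:R]natr1 !mulrDl !mul1r !ler_norml.
by move=> /andP[? ?] /andP[? ?]; apply/andP; split; lra.
Qed.

Lemma bounded_dyadic_multiples0 (x C : R) :
  (forall n : nat, 2 ^+ n * `|x| <= C) -> x = 0.
Proof.
move=> h; apply: (@bounded_multiples0 _ C) => k; apply: le_trans (h k).
by rewrite ler_wpM2r// -natrX ler_nat ltnW// ltn_expl.
Qed.

(** The homogenization of [phi] at [g] is the limit of [phi (g ^+ 2 ^ n) / 2 ^ n];
it is obtained as the unique real number lying within [C / 2 ^ n] of each of these
quotients, [C] being the defect of [phi]. *)
Lemma homogenization phi : quasimorphism phi ->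
  exists mu, [/\ quasimorphism mu, homogeneous mu &
    forall g, (forall k, phi (g ^+ k)%g = k%:R * phi g) -> mu g = phi g].
Proof.
move=> [C hC].
pose u g n : R := phi (g ^+ (2 ^ n))%g / 2 ^+ n.
have p2 n : 0 < 2 ^+ n :> R by rewrite exprn_gt0.
have C0 : 0 <= C by apply: le_trans (hC 1%g 1%g).
have step g n : `|u g n.+1 - u g n| <= C / 2 ^+ n.+1.
  have -> : u g n.+1 - u g n =
      (phi (g ^+ (2 ^ n) * g ^+ (2 ^ n))%g - phi (g ^+ (2 ^ n))%g
        - phi (g ^+ (2 ^ n))%g) / 2 ^+ n.+1.
    rewrite /u expnS mulnC expgnA expg2 exprS; field.
    by rewrite gt_eqF.
  by rewrite normrM normfV [`|2 ^+ _|]gtr0_norm// ler_pM2r ?invr_gt0.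
have far g n m : `|u g (n + m)%N - u g n| <= C / 2 ^+ n - C / 2 ^+ (n + m).
  elim: m => [|m IH]; first by rewrite addn0 !subrr normr0.
  have := step g (n + m)%N; move: IH; rewrite addnS [2 ^+ (n + m).+1]exprS.
  have -> : C / (2 * 2 ^+ (n + m)) = (C / 2 ^+ (n + m)) / 2.
    by field; rewrite gt_eqF.
  by rewrite !ler_norml => /andP[? ?] /andP[? ?]; apply/andP; split; lra.
have cross g n m : u g n - C / 2 ^+ n <= u g m + C / 2 ^+ m.
  have Cp k : 0 <= C / 2 ^+ k by rewrite divr_ge0// ltW.
  wlog nm : n m / (n <= m)%N => [W|].
    have [/W//|/ltnW mn] := leqP n m.
    have := far g m (n - m)%N; rewrite subnKC// ler_norml => /andP[? ?].
    by have := Cp n; lra.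
  have := far g n (m - n)%N; rewrite subnKC// ler_norml => /andP[? ?].
  by have := Cp m; lra.
pose E g := range (fun n => u g n - C / 2 ^+ n).
have supE g : has_sup (E g).
  split; first by exists (u g 0%N - C / 2 ^+ 0), 0%N.
  by exists (u g 0%N + C / 2 ^+ 0) => _ [n _ <-]; exact: cross.
pose mu g := sup (E g).
have muP g n : `|2 ^+ n * mu g - phi (g ^+ (2 ^ n))%g| <= C.
  have lo : u g n - C / 2 ^+ n <= mu g.
    by apply: sup_upper_bound => //; exists n.
  have hi : mu g <= u g n + C / 2 ^+ n.
    apply: ge_sup; first by case: (supE g).
    by move=> _ [m _ <-]; exact: cross.
  move: lo hi; rewrite /u -mulrBl -mulrDl ler_pdivrMr// ler_pdivlMr// => lo hi.
  by rewrite ler_norml mulrC; apply/andP; split; lra.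
exists mu; split.
- exists (4 * C) => g h; have := hC g h.
  have := muP g 0%N; have := muP h 0%N; have := muP (g * h)%g 0%N.
  rewrite !mul1r !expg1 !ler_norml.
  move=> /andP[? ?] /andP[? ?] /andP[? ?] /andP[? ?].
  by apply/andP; split; lra.
- move=> g k; apply/eqP; rewrite -subr_eq0; apply/eqP.
  apply: (@bounded_dyadic_multiples0 _ (C + k.+1%:R * C + k%:R * C)) => n.
  rewrite -[2 ^+ n]gtr0_norm// -normrM mulrBr.
  have := muP (g ^+ k)%g n; have := quasimorphism_pow hC (g ^+ (2 ^ n))%g k.
  have : `|k%:R * (2 ^+ n * mu g - phi (g ^+ (2 ^ n))%g)| <= k%:R * C.
    by rewrite normrM normr_nat ler_wpM2l.
  rewrite -!expgnA mulnC mulrBr [2 ^+ n * (k%:R * _)]mulrCA !ler_norml.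
  move=> /andP[? ?] /andP[? ?] /andP[? ?].
  by apply/andP; split; lra.
- move=> g hg; apply/eqP; rewrite -subr_eq0; apply/eqP.
  apply: (@bounded_dyadic_multiples0 _ C) => n.
  rewrite -[2 ^+ n]gtr0_norm// -normrM mulrBr.
  by have := muP g n; rewrite hg natrX.
Qed.

End HomogeneousQuasimorphisms.

(** * Smooth calculus on the line *)

Section SmoothCalculus.
Variable R : realType.
Implicit Types (f g : R -> R) (k : nat).

Lemma Ck_id k : Ck k (@id R).
Proof.
case: k => [|k] /=; first by move=> t; exact: derivable_id.
split; first by move=> t; exact: derivable_id.
suff -> : derive1 (@id R) = cst 1 by exact: Ck_cst.
by apply/funext => t; rewrite derive1E derive_id.
Qed.

Lemma Ck_comp k f g : Ck k f -> Ck k g -> Ck k (f \o g).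
Proof.
elim: k f => [|k IH] f Cf Cg.
  move=> t; apply/derivable1_diffP; apply: differentiable_comp.
    by apply/derivable1_diffP; exact: Cg.
  by apply/derivable1_diffP; exact: Cf.
have [df Cf'] := Cf; have [dg Cg'] := Cg.
have dfg t : derivable (f \o g) t 1.
  apply/derivable1_diffP; apply: differentiable_comp.
    by apply/derivable1_diffP.
  by apply/derivable1_diffP.
split=> //.
have -> : derive1 (f \o g) = fun t => (derive1 f \o g) t * derive1 g t.
  by apply/funext => t; rewrite derive1_comp.
by apply: CkM => //; apply: IH => //; exact: CkS.
Qed.

Lemma CkV k f : (forall t, f t != 0) -> Ck k f -> Ck k (fun t => (f t)^-1).
Proof.
move=> f0; have dV (df : forall t, derivable f t 1) t :
    is_derive (t : R) (1 : R) (fun t : R => (f t)^-1) (- (f t) ^- 2 *: derive1 f t).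
  have dt := derivableP (df t).
  by rewrite derive1E; apply: is_deriveV; exact: f0.
elim: k => [|k IH] Cf; first by move=> t; case: (dV Cf t).
have [df Cf'] := Cf; split; first by move=> t; case: (dV df t).
have -> : derive1 (fun t : R => (f t)^-1) =
    fun t => ((-1) * ((f t)^-1 * (f t)^-1)) * derive1 f t.
  apply/funext => t; rewrite derive1E (@derive_val _ _ _ _ _ _ _ (dV df t)).
  by rewrite mulN1r -invfM -expr2.
have CV := IH (CkS Cf).
by apply: CkM => //; apply: CkM; [exact: Ck_cst | exact: CkM].
Qed.

(** The derivative of [sqrt f] is [f' / (2 sqrt f)], in which [sqrt f] occurs with one
derivative less to control. *)
Lemma Ck_sqrt k f : (forall t, 0 < f t) -> Ck k f -> Ck k (fun t => Num.sqrt (f t)).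
Proof.
move=> f0 Cf.
have ds (df : forall t, derivable f t 1) t :
    derivable (fun t => Num.sqrt (f t)) t 1 /\
    derive1 (fun t => Num.sqrt (f t)) t = (2 * Num.sqrt (f t))^-1 * derive1 f t.
  have h := @is_derive1_sqrt R (f t) (f0 t).
  have [d1 d2] := h.
  split.
    apply/derivable1_diffP; apply: (@differentiable_comp _ _ _ _ f Num.sqrt).
      exact: (derivable1_diffP _ _).1 (df t).
    exact: (derivable1_diffP _ _).1 d1.
  by rewrite (derive1_comp (df t) d1) !derive1E d2.
elim: k Cf => [|k IH] Cf; first by move=> t; have [] := ds Cf t.
have [df Cf'] := Cf; split; first by move=> t; have [] := ds df t.
have -> : derive1 (fun t => Num.sqrt (f t)) =
    fun t => (2 * Num.sqrt (f t))^-1 * derive1 f t.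
  by apply/funext => t; have [] := ds df t.
apply: CkM => //; apply: CkV.
  by move=> t; rewrite mulf_neq0// ?pnatr_eq0// gt_eqF// sqrtr_gt0.
by apply: CkM; [exact: Ck_cst | exact/IH/CkS].
Qed.

(** The two functions are each other's derivatives up to sign, hence the joint
induction. *)
Lemma Ck_sin_cos k : Ck k (@sin R) /\ Ck k (@cos R).
Proof.
have ds : derive1 (@sin R) = cos.
  by apply/funext => t; rewrite derive1E derive_val.
have dc : derive1 (@cos R) = fun t => (-1) * sin t.
  by apply/funext => t; rewrite derive1E derive_val mulN1r.
elim: k => [|k [IHs IHc]] /=.
  by split=> t; [exact: derivable_sin | exact: derivable_cos].
rewrite ds dc; split; split=> //.
by apply: CkM => //; exact: Ck_cst.
Qed.

(* Unification should not unfold smoothness into derivability conditions. *)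
Local Opaque Ck smooth.

Lemma smooth_id : smooth (@id R).
Proof. by apply/Ck_smooth => k; exact: Ck_id. Qed.

Lemma smooth_comp f g : smooth f -> smooth g -> smooth (f \o g).
Proof. by move=> /Ck_smooth sf /Ck_smooth sg; apply/Ck_smooth => k; exact: Ck_comp. Qed.

Lemma smoothM f g : smooth f -> smooth g -> smooth (fun t => f t * g t).
Proof. by move=> /Ck_smooth sf /Ck_smooth sg; apply/Ck_smooth => k; exact: CkM. Qed.

Lemma smoothD (V : normedModType R) (f g : R -> V) :
  smooth f -> smooth g -> smooth (fun t => f t + g t).
Proof. by move=> /Ck_smooth sf /Ck_smooth sg; apply/Ck_smooth => k; exact: CkD. Qed.

Lemma smoothV f : (forall t, f t != 0) -> smooth f -> smooth (fun t => (f t)^-1).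
Proof. by move=> f0 /Ck_smooth sf; apply/Ck_smooth => k; exact: CkV. Qed.

Lemma smooth_sqrt f : (forall t, 0 < f t) -> smooth f ->
  smooth (fun t => Num.sqrt (f t)).
Proof. by move=> f0 /Ck_smooth sf; apply/Ck_smooth => k; exact: Ck_sqrt. Qed.

Lemma smooth_sin : smooth (@sin R).
Proof. by apply/Ck_smooth => k; case: (Ck_sin_cos k). Qed.

Lemma smooth_cos : smooth (@cos R).
Proof. by apply/Ck_smooth => k; case: (Ck_sin_cos k). Qed.

Lemma smoothZl (c : R) f : smooth f -> smooth (fun t => c * f t).
Proof.
move=> /Ck_smooth sf; apply/Ck_smooth => k; apply: CkM; last exact: sf.
exact: Ck_cst.
Qed.

Lemma smooth_big_sum (I : Type) (r : seq I) (P : pred I) (F : I -> R -> R) :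
  (forall i, smooth (F i)) -> smooth (fun t => \sum_(i <- r | P i) F i t).
Proof.
move=> sF; elim: r => [|i r IH].
  rewrite (_ : (fun _ => _) = fun=> 0); first exact: smooth_cst.
  by apply/funext => t; rewrite big_nil.
case Pi: (P i); last first.
  rewrite (_ : (fun _ => _) = fun t => \sum_(j <- r | P j) F j t) //.
  by apply/funext => t; rewrite big_cons Pi.
rewrite (_ : (fun _ => _) = fun t => F i t + \sum_(j <- r | P j) F j t).
  exact: (smoothD (sF i) IH).
by apply/funext => t; rewrite big_cons Pi.
Qed.

Lemma smooth_big_prod (I : Type) (r : seq I) (P : pred I) (F : I -> R -> R) :
  (forall i, smooth (F i)) -> smooth (fun t => \prod_(i <- r | P i) F i t).
Proof.
move=> sF; elim: r => [|i r IH].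
  rewrite (_ : (fun _ => _) = fun=> 1); first exact: smooth_cst.
  by apply/funext => t; rewrite big_nil.
case Pi: (P i); last first.
  rewrite (_ : (fun _ => _) = fun t => \prod_(j <- r | P j) F j t) //.
  by apply/funext => t; rewrite big_cons Pi.
rewrite (_ : (fun _ => _) = fun t => F i t * \prod_(j <- r | P j) F j t).
  exact: (smoothM (sF i) IH).
by apply/funext => t; rewrite big_cons Pi.
Qed.

Lemma smooth_mxP m n (M : R -> 'M[R]_(m, n)) :
  smooth M <-> forall i j, smooth (fun t => M t i j).
Proof.
split=> [/Ck_smooth sM i j|sM].
  by apply/Ck_smooth => k; apply: (Ck_mxP _ _).1; exact: sM.
apply/Ck_smooth => k; apply/Ck_mxP => i j.
by move: k; apply/Ck_smooth.
Qed.

Lemma smooth_mx_entry m n (M : R -> 'M[R]_(m, n)) i j :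
  smooth M -> smooth (fun t => M t i j).
Proof. by move=> /smooth_mxP. Qed.

Lemma smooth_mx_comp m n (M : R -> 'M[R]_(m, n)) f :
  smooth M -> smooth f -> smooth (M \o f).
Proof.
move=> sM sf; apply/smooth_mxP => i j.
exact: (smooth_comp (@smooth_mx_entry _ _ _ i j sM) sf).
Qed.

Lemma smooth_scalemx m n f (M : R -> 'M[R]_(m, n)) :
  smooth f -> smooth M -> smooth (fun t => f t *: M t).
Proof.
move=> sf sM; apply/smooth_mxP => i j; under eq_fun do rewrite mxE.
exact: (smoothM sf (@smooth_mx_entry _ _ _ i j sM)).
Qed.

Lemma smooth_oppmx m n (M : R -> 'M[R]_(m, n)) :
  smooth M -> smooth (fun t => - M t).
Proof.
move=> sM; under eq_fun do rewrite -scaleN1r.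
by apply: smooth_scalemx => //; exact: smooth_cst.
Qed.

Lemma smooth_submxs m1 m2 n1 n2 (M : R -> 'M[R]_(m1 + m2, n1 + n2)) :
  smooth M -> [/\ smooth (fun t => ulsubmx (M t)), smooth (fun t => ursubmx (M t)),
     smooth (fun t => dlsubmx (M t)) & smooth (fun t => drsubmx (M t))].
Proof.
move=> sM; split; apply/smooth_mxP => i j; under eq_fun do rewrite !mxE;
  exact: smooth_mx_entry.
Qed.

Lemma smooth_block_mx m1 m2 n1 n2 (A : R -> 'M[R]_(m1, n1)) (B : R -> 'M[R]_(m1, n2))
    (C : R -> 'M[R]_(m2, n1)) (D : R -> 'M[R]_(m2, n2)) :
  smooth A -> smooth B -> smooth C -> smooth D ->
  smooth (fun t => block_mx (A t) (B t) (C t) (D t)).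
Proof.
move=> sA sB sC sD; apply/smooth_mxP => i j; under eq_fun do rewrite mxE.
case: (fintype.split i) => i'; under eq_fun do rewrite mxE;
  by case: (fintype.split j) => j'; exact: smooth_mx_entry.
Qed.

Lemma smooth_scalar_mx n f : smooth f -> smooth (fun t => (f t)%:M : 'M[R]_n).
Proof.
move=> sf; apply/smooth_mxP => i j; under eq_fun do rewrite mxE.
by case: (i == j) => /=; [exact: sf | exact: smooth_cst].
Qed.

Lemma smooth_diag_mx n (d : R -> 'rV[R]_n) :
  smooth d -> smooth (fun t => diag_mx (d t)).
Proof.
move=> sd; apply/smooth_mxP => i j; under eq_fun do rewrite mxE.
case: (i == j); rewrite /=; last exact: smooth_cst.
exact: smooth_mx_entry.
Qed.

Lemma smooth_det n (M : R -> 'M[R]_n) : smooth M -> smooth (fun t => \det (M t)).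
Proof.
move=> sM; rewrite /determinant.
apply: smooth_big_sum => s; apply: smoothZl.
by apply: smooth_big_prod => i; exact: smooth_mx_entry.
Qed.

Lemma smooth_invmx n (M : R -> 'M[R]_n) :
  (forall t, M t \in unitmx) -> smooth M -> smooth (fun t => invmx (M t)).
Proof.
move=> uM sM; under eq_fun => t do rewrite /invmx uM.
apply: smooth_scalemx.
  apply: smoothV; last exact: smooth_det.
  by move=> t; have := uM t; rewrite unitmxE unitfE.
apply/smooth_mxP => i j; under eq_fun do rewrite mxE.
apply: smoothZl.
apply: smooth_det; apply/smooth_mxP => a b; under eq_fun do rewrite !mxE.
exact: smooth_mx_entry.
Qed.

Lemma smooth_continuous (V : normedModType R) (f : R -> V) : smooth f -> continuous f.
Proof.
move=> sf t; apply: differentiable_continuous.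
by apply/derivable1_diffP; exact: (sf 0%N).
Qed.

End SmoothCalculus.

(** * Curves representing elements of the universal cover *)

Section GlobalCurves.
Variables (R : realType) (n : nat).
Local Opaque smooth.
Local Notation mx := 'M[R]_(n + n).
Implicit Types (F G : R -> mx) (A M : mx).

(** A path is constrained over [0, 1] only. Curves that are smooth and symplectic on the
whole line are easier to handle, as inverses and square roots of their entries are then
smooth everywhere; [curve_class_surj] shows that they suffice. *)
Definition sp_curve F :=
  [/\ smooth F, forall t, symplectic (F t) & F 0 = 1%:M].

Lemma sp_curve_smooth01 F : sp_curve F -> smooth_on01 F.
Proof. by case=> sF _ _; exists F. Qed.

Lemma sp_curve_symplectic01 F : sp_curve F ->
  {in `[0, 1], forall t, symplectic (F t)}.
Proof. by case=> _ sF _ t _. Qed.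

Lemma sp_curve0 F : sp_curve F -> F 0 = 1%:M.
Proof. by case. Qed.

Definition curve_path F (h : sp_curve F) : sp_path R n :=
  SpPath (sp_curve_smooth01 h) (sp_curve_symplectic01 h) (sp_curve0 h).

(** A total function of [F], so that classes can be rewritten pointwise; the neutral
element is a default value. *)
Definition curve_class F : SpTilde R n :=
  if pselect (sp_curve F) is left h then path_class (curve_path h) else 1%g.

Lemma sp_path_inj (Psi Phi : sp_path R n) :
  sp_fun Psi = sp_fun Phi -> Psi = Phi.
Proof.
case: Psi Phi => [F a b c] [G a' b' c'] /= E.
by case: _ / E a' b' c' => a' b' c'; f_equal; exact: Prop_irrelevance.
Qed.

Lemma curve_classE (Psi : sp_path R n) F :
  sp_curve F -> sp_fun Psi = F -> path_class Psi = curve_class F.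
Proof.
move=> hF PF; rewrite /curve_class; case: pselect => // h.
by congr path_class; apply: sp_path_inj.
Qed.

Lemma sp_curve1 : sp_curve (fun=> 1%:M).
Proof.
by split=> // [|_]; [exact: smooth_cst | exact: symplectic1].
Qed.

Lemma sp_curveM F G : sp_curve F -> sp_curve G -> sp_curve (fun t => F t *m G t).
Proof.
move=> [sF aF F0] [sG aG G0]; split; last by rewrite F0 G0 mulmx1.
  exact: smooth_mulmx.
by move=> t; exact: symplecticM.
Qed.

Lemma sp_curveV F : sp_curve F -> sp_curve (fun t => sp_inv (F t)).
Proof.
move=> [sF aF F0]; split; last by rewrite F0 sp_inv1.
  apply: smooth_mulmx; last exact: smooth_cst.
  by apply: smooth_mulmx; [exact: smooth_cst | exact: smooth_trmx].
by move=> t; exact: symplecticV.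
Qed.

Lemma sp_curveJ F A : symplectic A -> sp_curve F ->
  sp_curve (fun t => A *m F t *m sp_inv A).
Proof.
move=> sA [sF aF F0]; split; last by rewrite F0 mulmx1 mul_sp_inv.
  apply: smooth_mulmx; last exact: smooth_cst.
  by apply: smooth_mulmx; [exact: smooth_cst | exact: sF].
move=> t; apply: symplecticM; last exact: symplecticV.
exact: symplecticM.
Qed.

Lemma sp_curve_comp F (f : R -> R) : sp_curve F -> smooth f -> f 0 = 0 ->
  sp_curve (F \o f).
Proof.
move=> [sF aF F0] sf f0; split; last by rewrite /= f0.
  exact: smooth_mx_comp.
by move=> t /=.
Qed.

Lemma curve_class1 : curve_class (fun=> 1%:M) = 1%g.
Proof. by rewrite -(@curve_classE (path_one R n))//; exact: sp_curve1. Qed.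

Lemma curve_classM F G : sp_curve F -> sp_curve G ->
  curve_class (fun t => F t *m G t) = (curve_class F * curve_class G)%g.
Proof.
move=> hF hG.
rewrite -(@curve_classE (curve_path hF) F)// -(@curve_classE (curve_path hG) G)//.
rewrite -path_classM -(@curve_classE (path_mul (curve_path hF) (curve_path hG)))//.
exact: sp_curveM.
Qed.

Lemma curve_classV F : sp_curve F ->
  curve_class (fun t => sp_inv (F t)) = (curve_class F)^-1%g.
Proof.
move=> hF; apply/esym/mulg1_eq; rewrite -curve_classM//; last exact: sp_curveV.
rewrite -curve_class1; congr curve_class; apply/funext => t.
by rewrite mul_sp_inv//; case: hF.
Qed.

Fixpoint mx_pow A k := if k is k'.+1 then A *m mx_pow A k' else 1%:M.

Lemma sp_curveX F k : sp_curve F -> sp_curve (fun t => mx_pow (F t) k).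
Proof.
by move=> hF; elim: k => [|k IH]; [exact: sp_curve1 | exact: sp_curveM].
Qed.

Lemma curve_classX F k : sp_curve F ->
  curve_class (fun t => mx_pow (F t) k) = (curve_class F ^+ k)%g.
Proof.
move=> hF; elim: k => [|k IH]; first by rewrite expg0 -curve_class1.
by rewrite expgS -IH -curve_classM//; exact: sp_curveX.
Qed.

Lemma homotopic_curve_class F G (H : R * R -> mx) :
  sp_curve F -> sp_curve G -> continuous H ->
  {in `[0, 1] &, forall s t, symplectic (H (s, t))} ->
  (forall t, H (0, t) = F t) -> (forall t, H (1, t) = G t) ->
  (forall s, H (s, 0) = 1%:M) -> (forall s, H (s, 1) = F 1) ->
  curve_class F = curve_class G.
Proof.
move=> hF hG cH sH H0 H1 Hs0 Hs1.
rewrite -(@curve_classE (curve_path hF) F)// -(@curve_classE (curve_path hG) G)//.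
apply/path_classP; exists H; split=> //.
exact: continuous_subspaceT.
Qed.

(** A smooth map of the line onto [0, 1] that fixes 0 and 1. *)
Definition ramp (t : R) : R := sin (t * (pi / 2)) ^+ 2.

Lemma smooth_ramp : smooth ramp.
Proof.
have h : smooth (fun t : R => sin (t * (pi / 2))).
  apply: (@smooth_comp _ sin (fun t => t * (pi / 2))); first exact: smooth_sin.
  under eq_fun do rewrite mulrC; apply: smoothZl; exact: smooth_id.
have -> : ramp = fun t => sin (t * (pi / 2)) * sin (t * (pi / 2)).
  by apply/funext => t; rewrite /ramp expr2.
exact: (smoothM h h).
Qed.

Lemma ramp0 : ramp 0 = 0.
Proof. by rewrite /ramp mul0r sin0 expr0n. Qed.

Lemma ramp1 : ramp 1 = 1.
Proof. by rewrite /ramp mul1r sin_pihalf expr1n. Qed.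

Lemma ramp_itv t : 0 <= ramp t <= 1.
Proof.
rewrite /ramp sqr_ge0 /= -[leRHS](cos2Dsin2 (t * (pi / 2))).
by rewrite lerDr sqr_ge0.
Qed.

Lemma ramp_homotopy_continuous :
  continuous (fun x : R * R => (1 - x.1) * x.2 + x.1 * ramp x.2).
Proof.
move=> x.
have c1 : y.1 @[y --> x] --> x.1 by exact: cvg_fst.
have c2 : y.2 @[y --> x] --> x.2 by exact: cvg_snd.
apply: cvgD; first by apply: cvgM => //; apply: cvgB => //; exact: cvg_cst.
apply: cvgM => //.
apply: (cvg_comp _ _ c2); exact: (smooth_continuous smooth_ramp).
Qed.

(** Composition with [ramp] only uses the values over [0, 1]; the homotopy moves [t] to
[ramp t] along a segment. *)
Lemma path_class_curve (Psi : sp_path R n) (F : R -> mx) :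
  smooth F -> {in `[0, 1], Psi =1 F} ->
  sp_curve (F \o ramp) /\ path_class Psi = curve_class (F \o ramp).
Proof.
move=> sF PF.
have I0 : (0 : R) \in `[0, 1] by rewrite in_itv /= lexx ler01.
have I1 : (1 : R) \in `[0, 1] by rewrite in_itv /= lexx ler01.
have hc : sp_curve (F \o ramp).
  split; first exact: smooth_mx_comp smooth_ramp.
    move=> t /=; have It : ramp t \in `[0, 1] by rewrite in_itv /= ramp_itv.
    by rewrite -PF//; exact: sp_symplectic.
  by rewrite /= ramp0 -PF// sp_path0.
split=> //; rewrite -(@curve_classE (curve_path hc) (F \o ramp))//.
apply/path_classP.
have conv s t : s \in `[0, 1] -> t \in `[0, 1] ->
    (1 - s) * t + s * ramp t \in `[0 : R, 1].
  have /andP[r0 r1] := ramp_itv t.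
  rewrite !in_itv /= => /andP[s0 s1] /andP[t0 t1]; apply/andP; split; nra.
exists (F \o (fun x : R * R => (1 - x.1) * x.2 + x.1 * ramp x.2)); split.
- apply: continuous_subspaceT => x; apply: continuous_comp.
    exact: ramp_homotopy_continuous.
  exact: (smooth_continuous sF).
- by move=> s t Is It; rewrite /= -PF; [apply: sp_symplectic|]; exact: conv.
- move=> t It /=; rewrite subr0 mul1r mul0r addr0 subrr mul0r mul1r add0r.
  by rewrite PF.
- move=> s Is /=; rewrite mulr0 ramp0 mulr0 addr0 mulr1 ramp1 mulr1 subrK.
  by rewrite -!PF// sp_path0.
Qed.

Lemma curve_class_ramp F : sp_curve F -> curve_class (F \o ramp) = curve_class F.
Proof.
move=> hF; have [sF _ _] := hF.
have [_ <-] := @path_class_curve (curve_path hF) F sF (fun=> fun=> erefl).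
exact: curve_classE.
Qed.

Lemma curve_class_surj (g : SpTilde R n) : exists2 F, sp_curve F & g = curve_class F.
Proof.
have -> : g = path_class (repr g) by rewrite /path_class reprK.
have [F [sF PF]] := sp_smooth (repr g).
by have [? ?] := path_class_curve sF PF; exists (F \o ramp).
Qed.

Lemma path_class_curve_surj (Psi : sp_path R n) :
  exists2 F, sp_curve F & path_class Psi = curve_class F /\ F 1 = Psi 1.
Proof.
have I1 : (1 : R) \in `[0, 1] by rewrite in_itv /= lexx ler01.
have [F [sF PF]] := sp_smooth Psi.
have [? ?] := path_class_curve sF PF; exists (F \o ramp) => //.
by rewrite /= ramp1 PF.
Qed.

(** Conjugation in the universal cover only depends on the endpoint of the
conjugating path: slide the conjugating element along its path to its end. *)
Lemma curve_classJ F G : sp_curve F -> sp_curve G ->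
  curve_class (fun t => G 1 *m F t *m sp_inv (G 1)) =
  (curve_class G * curve_class F * (curve_class G)^-1)%g.
Proof.
move=> hF hG; rewrite -curve_classV// -curve_classM// -curve_classM; first last.
- exact: sp_curveV.
- exact: sp_curveM.
have [[sF aF F0] [sG aG G0]] := (hF, hG).
pose r (x : R * R) := (1 - x.1) * x.2 + x.1.
have cr : continuous r.
  move=> x.
  have c1 : y.1 @[y --> x] --> x.1 by exact: cvg_fst.
  have c2 : y.2 @[y --> x] --> x.2 by exact: cvg_snd.
  by apply: cvgD => //; apply: cvgM => //; apply: cvgB => //; exact: cvg_cst.
apply/esym; pose H x := G (r x) *m F x.2 *m sp_inv (G (r x)).
apply: (@homotopic_curve_class _ _ H).
- by apply: sp_curveM (sp_curveV hG); exact: sp_curveM.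
- exact: sp_curveJ.
- move=> x.
  have cG : G (r y) @[y --> x] --> G (r x).
    by apply: (cvg_comp _ _ (cr x)); exact: (smooth_continuous sG).
  apply: cvg_mulmx.
    apply: cvg_mulmx => //.
    apply: (cvg_comp _ _ (@cvg_snd _ _ (nbhs x.1) (nbhs x.2) _)).
    exact: (smooth_continuous sF).
  apply: cvg_mulmx; last exact: cvg_cst.
  by apply: cvg_mulmx; [exact: cvg_cst | exact: cvg_trmx].
- move=> s t _ _; rewrite /H /=; apply: symplecticM; last exact: symplecticV.
  exact: symplecticM.
- by move=> t; rewrite /H /r /= subr0 mul1r addr0.
- by move=> t; rewrite /H /r /= subrr mul0r add0r.
- by move=> s; rewrite /H /r /= mulr0 add0r F0 mulmx1 mul_sp_inv.
- by move=> s; rewrite /H /r /= mulr1 subrK.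
Qed.

End GlobalCurves.

(** * Smooth LDU factorization of positive matrices *)

Local Notation mxs := (addr0, add0r, mulmx0, mul0mx, mul1mx, mulmx1).

Section PositiveMatrices.
Variable R : realType.

(** Positivity of the quadratic form; the matrix need not be symmetric. *)
Definition posmx n (A : 'M[R]_n) :=
  forall x : 'rV[R]_n, x != 0 -> 0 < (x *m A *m x^T) 0 0.

Lemma posmx_unit n (A : 'M[R]_n) : posmx A -> A \in unitmx.
Proof.
move=> pA; rewrite -row_free_unit -kermx_eq0; apply/negPn/negP => K0.
have x0 : nz_row (kermx A) != 0 by rewrite nz_row_eq0.
have := pA _ x0; have /sub_kermxP -> := nz_row_sub (kermx A).
by rewrite mul0mx mxE ltxx.
Qed.

Lemma posmx_ulcorner n (a : 'M[R]_1) b c (A : 'M[R]_n) :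
  posmx (block_mx a b c A : 'M[R]_(1 + n)) -> 0 < a 0 0.
Proof.
move=> /(_ (row_mx 1%:M 0)).
rewrite mul_row_block !mul0mx !mul1mx !addr0 tr_row_mx trmx1 trmx0 mul_row_col.
rewrite mulmx1 mulmx0 addr0; apply.
apply/eqP => /(congr1 lsubmx); rewrite row_mxKl => /matrixP/(_ 0 0).
by rewrite !mxE; apply/eqP; rewrite oner_eq0.
Qed.

(** The form of the Schur complement at [x] is that of the whole matrix at [x] completed
by the first coordinate [u] for which the first entry of the image vanishes. *)
Lemma posmx_schur n (a : 'M[R]_1) b c (A : 'M[R]_n) :
  posmx (block_mx a b c A : 'M[R]_(1 + n)) ->
  posmx (A - (a 0 0)^-1 *: (c *m b)).
Proof.
move=> pA; have a0 := posmx_ulcorner pA; move=> x x0.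
set u : 'M[R]_1 := - (a 0 0)^-1 *: (x *m c).
have /pA : (row_mx u x : 'rV[R]_(1 + n)) != 0.
  apply: contra x0 => /eqP/(congr1 rsubmx); rewrite row_mxKr => ->.
  by apply/eqP/matrixP => i j; rewrite !mxE.
rewrite mul_row_block tr_row_mx mul_row_col.
have -> : u *m a + x *m c = 0.
  rewrite [a]mx11_scalar mul_mx_scalar /u scalerA mulrN mulfV ?gt_eqF//.
  by rewrite scaleN1r addNr.
rewrite mul0mx add0r mulmxBr -scalemxAr /u -scalemxAl scaleNr.
by rewrite [- _ + _]addrC mulmxA.
Qed.

Lemma posmx1 n : posmx (1%:M : 'M[R]_n).
Proof.
move=> x x0; rewrite mulmx1 mxE; under eq_bigr do rewrite mxE -expr2.
rewrite lt0r sumr_ge0 => [|i _]; last exact: sqr_ge0.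
rewrite andbT; apply: contra x0; rewrite psumr_eq0 => [/allP h|i _]; last exact: sqr_ge0.
apply/eqP/matrixP => i j; rewrite (ord1 i) mxE; apply/eqP; rewrite -sqrf_eq0.
exact: h (mem_index_enum _).
Qed.

Lemma posmx_gram n (A B : 'M[R]_n) :
  (forall x : 'rV[R]_n, x *m A^T = 0 -> x *m B^T = 0 -> x = 0) ->
  posmx (A^T *m A + B^T *m B).
Proof.
move=> h; have sq (x : 'rV[R]_n) (M : 'M[R]_n) :
    x *m (M^T *m M) *m x^T = (x *m M^T) *m 1%:M *m (x *m M^T)^T.
  by rewrite mulmx1 trmx_mul trmxK !mulmxA.
have ge (y : 'rV[R]_n) : 0 <= (y *m 1%:M *m y^T) 0 0.
  have [->|/posmx1/ltW//] := eqVneq y 0; by rewrite !mul0mx mxE.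
move=> x x0; rewrite mulmxDr mulmxDl mxE !sq.
have [A0|/posmx1 A0] := eqVneq (x *m A^T) 0.
  have [B0|/posmx1 B0] := eqVneq (x *m B^T) 0; first by rewrite (h _ A0 B0) eqxx in x0.
  by rewrite ltr_wpDl.
by rewrite ltr_pwDl.
Qed.

End PositiveMatrices.

Section SmoothLDU.
Local Opaque smooth.
Variable R : realType.

(** The projector [E], constant in time, is
what matters: the dilation [1 + E] conjugates [1 + N] into its square, see
[value_unip1]. *)
Inductive unip_curve n : nat -> (R -> 'M[R]_n) -> Prop :=
| unip_curve_nil : unip_curve 0 (fun=> 1%:M)
| unip_curve_cons k (E : 'M[R]_n) (N A : R -> 'M[R]_n) :
    E *m E = E -> smooth N -> N 0 = 0 ->
    (forall t, E *m N t = N t) -> (forall t, N t *m E = 0) ->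
    unip_curve k A -> unip_curve k.+1 (fun t => (1%:M + N t) *m A t).

Lemma unip_curve_smooth n k (A : R -> 'M[R]_n) : unip_curve k A -> smooth A.
Proof.
elim=> [|{}k E N {}A _ sN _ _ _ _ IH]; first exact: smooth_cst.
apply: smooth_mulmx; last exact: IH.
by apply: smoothD; [exact: smooth_cst | exact: sN].
Qed.

Lemma unip_curve0 n k (A : R -> 'M[R]_n) : unip_curve k A -> A 0 = 1%:M.
Proof. by elim=> // {}k E N {}A _ _ N0 _ _ _ ->; rewrite N0 addr0 mulmx1. Qed.

Lemma sqr0_unit n (N : 'M[R]_n) : N *m N = 0 -> 1%:M + N \in unitmx.
Proof.
move=> NN; have : (1%:M + N) *m (1%:M - N) = 1%:M.
  by rewrite mulmxDl mul1mx mulmxBr mulmx1 NN subr0 subrK.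
by case/mulmx1_unit.
Qed.

Lemma unip_sqr0 n (E N : 'M[R]_n) : E *m N = N -> N *m E = 0 -> N *m N = 0.
Proof. by move=> EN NE; rewrite -{2}EN mulmxA NE mul0mx. Qed.

Lemma unip_curve_unit n k (A : R -> 'M[R]_n) :
  unip_curve k A -> forall t, A t \in unitmx.
Proof.
elim=> [t|{}k E N {}A _ sN _ EN NE _ IH t]; first exact: unitmx1.
by rewrite unitmx_mul IH andbT; apply: sqr0_unit; exact: unip_sqr0 (EN t) (NE t).
Qed.

Lemma unip_curve_cat n k l (A B : R -> 'M[R]_n) :
  unip_curve k A -> unip_curve l B -> unip_curve (k + l) (fun t => A t *m B t).
Proof.
move=> uA uB; elim: uA => [|{}k E N {}A EE sN N0 EN NE _ IH].
  by under eq_fun do rewrite mul1mx.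
under eq_fun do rewrite -mulmxA.
exact: unip_curve_cons EE sN N0 EN NE IH.
Qed.

Lemma unip_curve1 n (E : 'M[R]_n) N :
    E *m E = E -> smooth N -> N 0 = 0 ->
    (forall t, E *m N t = N t) -> (forall t, N t *m E = 0) ->
  unip_curve 1 (fun t => 1%:M + N t).
Proof.
move=> EE sN N0 EN NE.
have := unip_curve_cons EE sN N0 EN NE (unip_curve_nil n).
by under eq_fun do rewrite mulmx1.
Qed.

Lemma unip_curve_embed n k (A : R -> 'M[R]_n) : unip_curve k A ->
  unip_curve k (fun t => block_mx 1%:M 0 0 (A t) : 'M[R]_(1 + n)).
Proof.
elim=> [|{}k E N {}A EE sN N0 EN NE _ IH].
  under eq_fun do rewrite -scalar_mx_block; exact: unip_curve_nil.
have := @unip_curve_cons (1 + n) k (block_mx 0 0 0 E)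
  (fun t => block_mx 0 0 0 (N t)) _ _ _ _ _ _ IH.
rewrite (_ : (fun t => (1%:M + block_mx 0 0 0 (N t)) *m block_mx 1%:M 0 0 (A t)) =
   fun t => block_mx 1%:M 0 0 ((1%:M + N t) *m A t) : 'M[R]_(1 + n)); last first.
  apply/funext => t; rewrite scalar_mx_block add_block_mx mulmx_block.
  by rewrite !mxs.
apply.
- by rewrite mulmx_block !mxs EE.
- by apply: smooth_block_mx; [exact: smooth_cst .. | exact: sN].
- by rewrite N0 block_mx0.
- by move=> t; rewrite mulmx_block !mxs EN.
- by move=> t; rewrite mulmx_block !mxs NE block_mx0.
Qed.

(** Gaussian elimination without pivoting: positivity makes the first entry positive and
is inherited by the Schur complement, so that no pivot vanishes at any time. *)
Lemma smooth_LDU n (A : R -> 'M[R]_n) :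
  smooth A -> A 0 = 1%:M -> (forall t, posmx (A t)) ->
  exists L (d : R -> 'rV[R]_n) U,
  [/\ unip_curve n L, unip_curve n U,
    [/\ smooth d, forall t j, 0 < d t 0 j & d 0 = const_mx 1],
    forall t, A t = L t *m diag_mx (d t) *m U t &
    (forall t, (A t)^T = A t) -> forall t, L t = (U t)^T].
Proof.
elim: n A => [|n IH] A.
  move=> _ _ _; exists (fun=> 1%:M), (fun=> const_mx 1), (fun=> 1%:M).
  split; try exact: unip_curve_nil.
  - split; [exact: smooth_cst | by move=> t [] | by []].
  - by move=> t; rewrite flatmx0 [RHS]flatmx0.
  - by move=> _ t; rewrite trmx1.
move: A; rewrite -[n.+1]/(1 + n)%N => A sA A0 pA.
have [sa sb sc sd] := smooth_submxs sA.
pose a t := ulsubmx (A t) 0 0; pose b t := ursubmx (A t); pose c t := dlsubmx (A t).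
pose S t := drsubmx (A t) - (a t)^-1 *: (c t *m b t).
have pA' t : posmx (block_mx (ulsubmx (A t)) (b t) (c t) (drsubmx (A t))).
  by rewrite submxK; exact: pA.
have a0 t : 0 < a t := posmx_ulcorner (pA' t).
have an0 t : a t != 0 by rewrite gt_eqF.
have sa' : smooth a by exact: smooth_mx_entry.
have sV : smooth (fun t => (a t)^-1) by exact: smoothV.
have A0s := A0; move: A0s; rewrite scalar_mx_block -[A 0]submxK.
move=> /eq_block_mx[aE bE cE dE].
have a01 : a 0 = 1 by rewrite /a aE mxE.
have [||t|L [d [U [uL uU [sd' d0 d01] AE LU]]]] := IH S.
- apply: smoothD; first exact: sd.
  apply: smooth_oppmx; apply: smooth_scalemx; first exact: sV.
  exact: smooth_mulmx sc sb.
- by rewrite /S dE /c cE mul0mx scaler0 subr0.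
- exact: posmx_schur (pA' t).
pose lo t : 'M[R]_(1 + n) := block_mx 0 0 ((a t)^-1 *: c t) 0.
pose up t : 'M[R]_(1 + n) := block_mx 0 ((a t)^-1 *: b t) 0 0.
exists (fun t => (1%:M + lo t) *m block_mx 1%:M 0 0 (L t)).
exists (fun t => row_mx (a t)%:M (d t)).
exists (fun t => block_mx 1%:M 0 0 (U t) *m (1%:M + up t)).
split.
- apply: (@unip_curve_cat _ 1 n); last exact: unip_curve_embed.
  apply: (@unip_curve1 _ (block_mx 0 0 0 1%:M)).
  + by rewrite mulmx_block !mxs.
  + apply: smooth_block_mx;
      [exact: smooth_cst | exact: smooth_cst | exact: smooth_scalemx sV sc | exact: smooth_cst].
  + by rewrite /lo /c cE scaler0 block_mx0.
  + by move=> t; rewrite /lo mulmx_block !mxs.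
  + by move=> t; rewrite /lo mulmx_block !mxs block_mx0.
- rewrite [X in unip_curve X]addnC; apply: (@unip_curve_cat _ n 1); first exact: unip_curve_embed.
  apply: (@unip_curve1 _ (block_mx 1%:M 0 0 0)).
  + by rewrite mulmx_block !mxs.
  + apply: smooth_block_mx;
      [exact: smooth_cst | exact: smooth_scalemx sV sb | exact: smooth_cst | exact: smooth_cst].
  + by rewrite /up /b bE scaler0 block_mx0.
  + by move=> t; rewrite /up mulmx_block !mxs.
  + by move=> t; rewrite /up mulmx_block !mxs block_mx0.
- split.
  + apply/smooth_mxP => i j; under eq_fun do rewrite mxE.
    case: (fintype.split j) => k; last exact: smooth_mx_entry.
    under eq_fun do rewrite mxE; rewrite (ord1 i) (ord1 k) eqxx; exact: sa'.
  + move=> t j; rewrite mxE; case: (fintype.split j) => k //.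
    by rewrite mxE (ord1 k) eqxx mulr1n.
  + rewrite a01 d01; apply/matrixP => i j; rewrite !mxE; case: (fintype.split j) => k.
      by rewrite mxE (ord1 i) (ord1 k) eqxx.
    by rewrite mxE.
- move=> t; rewrite diag_mx_row.
  rewrite /lo /up {1 2}scalar_mx_block !add_block_mx !addr0 !add0r.
  rewrite !mulmx_block !mxs.
  rewrite -AE -[LHS]submxK.
  have -> : diag_mx (a t)%:M = (a t)%:M :> 'M[R]_1.
    by apply/matrixP => i j; rewrite (ord1 i) (ord1 j) !mxE !eqxx.
  rewrite mul_scalar_mx mul_mx_scalar !scalerA mulfV// !scale1r -mx11_scalar.
  by rewrite -scalemxAr /S addrC subrK.
- move=> sy t.
  have sy' : [/\ (ulsubmx (A t))^T = ulsubmx (A t), (c t)^T = b t, (b t)^T = c t &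
      (drsubmx (A t))^T = drsubmx (A t)].
    have := sy t; rewrite -{1 2}[A t]submxK tr_block_mx.
    by move=> /eq_block_mx[].
  have [_ cT bT _] := sy'.
  have SS u : (S u)^T = S u.
    have := sy u; rewrite -{1 2}[A u]submxK tr_block_mx => /eq_block_mx[_ h1 h2 h3].
    by rewrite /S linearB linearZ /= trmx_mul h3 /b /c h1 h2.
  rewrite trmx_mul [(1%:M + up t)^T]linearD /= trmx1 /lo /up !tr_block_mx !trmx0 trmx1.
  by rewrite linearZ /= bT (LU SS).
Qed.


End SmoothLDU.

(** * Symplectic matrices in block form *)

Section SymplecticBlocks.
Variables (R : realType) (n : nat).
Local Opaque smooth.
Implicit Types (A B C D : 'M[R]_n) (M : 'M[R]_(n + n)).

Lemma trJ0 : (J0 R n)^T = - J0 R n.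
Proof.
by rewrite /J0 tr_block_mx !trmx0 linearN /= trmx1 opp_block_mx !oppr0 opprK.
Qed.

Lemma trJ0_J0 : (J0 R n)^T *m J0 R n = 1%:M.
Proof. exact/mulmx1C/J0_trJ0. Qed.

Lemma symplecticT M : symplectic M -> symplectic M^T.
Proof.
move=> hM; have := congr1 (mulmx (J0 R n)^T) (mul_sp_invl hM).
rewrite /symplectic /sp_inv trmxK !mulmxA trJ0_J0 mul1mx mulmx1 trJ0.
by rewrite mulmxN mulNmx => /oppr_inj.
Qed.

Lemma symplectic_blockP A B C D : symplectic (block_mx A B C D) <->
  [/\ A *m B^T = B *m A^T, C *m D^T = D *m C^T & A *m D^T - B *m C^T = 1%:M].
Proof.
have E : block_mx A B C D *m J0 R n *m (block_mx A B C D)^T =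
    block_mx (B *m A^T - A *m B^T) (B *m C^T - A *m D^T)
             (D *m A^T - C *m B^T) (D *m C^T - C *m D^T).
  rewrite /J0 mulmx_block !mxs !mulmxN !mulmx1 tr_block_mx mulmx_block.
  by rewrite !mulNmx.
split=> [|[hAB hCD hAD]]; rewrite /symplectic E.
  rewrite /J0 => /eq_block_mx[h1 h2 _ h4]; split.
  - by apply/esym/eqP; rewrite -subr_eq0; apply/eqP.
  - by apply/esym/eqP; rewrite -subr_eq0; apply/eqP.
  - by rewrite -opprB h2 opprK.
have hDA : D *m A^T - C *m B^T = 1%:M.
  by rewrite -trmx1 -hAD linearB /= !trmx_mul !trmxK.
by rewrite hAB hCD !subrr hDA -[B *m _ - _]opprB hAD.
Qed.

Lemma symplectic_blockTP A B C D : symplectic (block_mx A B C D) ->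
  [/\ A^T *m C = C^T *m A, B^T *m D = D^T *m B & A^T *m D - C^T *m B = 1%:M].
Proof. by move=> /symplecticT; rewrite tr_block_mx => /symplectic_blockP; rewrite !trmxK. Qed.

Lemma sp_inv_block A B C D :
  sp_inv (block_mx A B C D) = block_mx D^T (- B^T) (- C^T) A^T.
Proof.
rewrite /sp_inv trJ0 /J0 tr_block_mx opp_block_mx !mulmx_block.
by rewrite !(oppr0, mxs, mulNmx, mulmxN, opprK).
Qed.

Lemma sp_inv_eq M N : symplectic M -> M *m N = 1%:M -> sp_inv M = N.
Proof.
move=> hM MN; rewrite -[RHS]mul1mx -(mul_sp_invl hM) -mulmxA MN.
by rewrite mulmx1.
Qed.

Lemma sp_inv_orthogonal M : symplectic M -> orthogonal_mx M -> sp_inv M = M^T.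
Proof. exact: sp_inv_eq. Qed.

(** The symplectic matrix acting by [A] on the first coordinate Lagrangian and by its
contragredient on the second one. *)
Definition gl_diag A : 'M[R]_(n + n) := block_mx A 0 0 (invmx A)^T.
Definition upper_shear B : 'M[R]_(n + n) := block_mx 1%:M B 0 1%:M.
Definition lower_shear C : 'M[R]_(n + n) := block_mx 1%:M 0 C 1%:M.

Lemma gl_diag_symplectic A : A \in unitmx -> symplectic (gl_diag A).
Proof.
move=> uA; apply/symplectic_blockP.
by rewrite !trmx0 !mulmx0 !mul0mx trmxK subr0 mulmxV.
Qed.

Lemma gl_diagM A B : A \in unitmx -> B \in unitmx ->
  gl_diag (A *m B) = gl_diag A *m gl_diag B.
Proof.
move=> uA uB; rewrite /gl_diag mulmx_block !mxs -trmx_mul; congr block_mx; congr trmx.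
have h : A *m B *m (invmx B *m invmx A) = 1%:M.
  by rewrite mulmxA mulmxK// mulmxV.
by rewrite -[LHS]mulmx1 -h mulKmx// unitmx_mul uA.
Qed.

Lemma gl_diag1 : gl_diag 1%:M = 1%:M.
Proof. by rewrite /gl_diag invmx1 trmx1 -scalar_mx_block. Qed.

Lemma upper_shear_symplectic B : B^T = B -> symplectic (upper_shear B).
Proof.
move=> BT; apply/symplectic_blockP.
by rewrite !(trmx0, trmx1, mxs, subr0).
Qed.

Lemma lower_shear_symplectic C : C^T = C -> symplectic (lower_shear C).
Proof.
move=> CT; apply/symplectic_blockP.
by rewrite !(trmx0, trmx1, mxs, subr0) CT.
Qed.

Lemma upper_shearD B B' : upper_shear B *m upper_shear B' = upper_shear (B' + B).
Proof. by rewrite /upper_shear mulmx_block !mxs. Qed.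

(** The lower right block is forced by the symplectic relation, which also makes the
shear symmetric. *)
Lemma symplectic_upper_factor A B D : A \in unitmx ->
  symplectic (block_mx A B 0 D) ->
  (invmx A *m B)^T = invmx A *m B /\
  block_mx A B 0 D = gl_diag A *m upper_shear (invmx A *m B).
Proof.
move=> uA /symplectic_blockTP[_ hB]; rewrite trmx0 mul0mx subr0 => hD.
have DE : D = (invmx A)^T.
  by rewrite -[LHS](mulKmx (_ : A^T \in unitmx)) ?unitmx_tr// hD mulmx1 trmx_inv.
split; first by move: hB; rewrite DE trmxK trmx_mul => ->.
by rewrite /gl_diag /upper_shear mulmx_block !mxs mulKVmx// DE.
Qed.

End SymplecticBlocks.

(** * Uniform continuity *)

Section UniformContinuity.
Variable R : realType.

(** Only one of the two points has to lie in the compact set. *)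
Lemma heine (T : pseudoMetricType R) (V : normedModType R) (K : set T) (f : T -> V) :
  compact K -> continuous f -> forall e : R, 0 < e ->
  exists2 d : R, 0 < d & forall x y, K x -> ball x d y -> `|f x - f y| < e.
Proof.
move=> /compact_near_coveringP cK cf e e0.
have : \forall d \near 0^'+, K `<=` [set x | forall y, ball x d y -> `|f x - f y| < e].
  apply: (cK R (0^'+) (fun d x => forall y, ball x d y -> `|f x - f y| < e)) => x Kx.
  have e2 : 0 < e / 2 by rewrite divr_gt0.
  have /nbhs_ballP[r /= r0 hr] : \forall y \near x, `|f x - f y| < e / 2.
    by have /cvgrPdist_lt := cf x; apply.
  have r2 : 0 < r / 2 by rewrite divr_gt0.
  near=> x' d => y xy.
  have dr : d <= r / 2 by near: d; apply: nbhs_right_le.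
  have xx' : ball x (r / 2) x' by near: x'; exact: nbhsx_ballx.
  have rr : r / 2 <= r by lra.
  have : `|f x - f x'| < e / 2 by apply: hr; exact: le_ball xx'.
  have : `|f x - f y| < e / 2.
    apply: hr; rewrite [r]splitr; apply: ball_triangle xx' _.
    exact: le_ball xy.
  move=> h2 h3 /=.
  have -> : f x' - f y = (f x - f y) - (f x - f x').
    by rewrite opprB [RHS]addrC addrA subrK.
  by apply: le_lt_trans (ler_normB _ _) _; rewrite [e]splitr ltrD.
move=> h.
have [d [d0 hd]] : exists d : R, 0 < d /\ K `<=` [set x | forall y, ball x d y -> `|f x - f y| < e].
  near (0 : R)^'+ => d; exists d; split; first by near: d; exact: nbhs_right_gt.
  by near: d.
by exists d => // x y Kx xy; exact: hd.
Unshelve. all: by end_near. Qed.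

Lemma mx_norm_entry m n (A B : 'M[R]_(m, n)) (e : R) i j :
  `|A - B| < e -> `|A i j - B i j| < e.
Proof.
move=> AB; have : ball A e B by rewrite mx_norm_ball.
by move=> [_ /(_ i j)]; rewrite -ball_normE.
Qed.

End UniformContinuity.

(** * The Frobenius distance *)

Section Frobenius.
Variable R : realType.

Definition frob m n (M : 'M[R]_(m, n)) : R := \sum_i \sum_j M i j ^+ 2.

Lemma frob_ge_entry m n (M : 'M[R]_(m, n)) i j : M i j ^+ 2 <= frob M.
Proof.
rewrite /frob (bigD1 i)//= (bigD1 j)//= -addrA lerDl addr_ge0//.
  by apply: sumr_ge0 => k _; exact: sqr_ge0.
by apply: sumr_ge0 => k _; apply: sumr_ge0 => l _; exact: sqr_ge0.
Qed.

Lemma frob_le m n (M : 'M[R]_(m, n)) (e : R) : (forall i j, `|M i j| <= e) ->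
  frob M <= (m * n)%:R * e ^+ 2.
Proof.
move=> Me; apply: (@le_trans _ _ (\sum_(i < m) \sum_(j < n) e ^+ 2)).
  apply: ler_sum => i _; apply: ler_sum => j _.
  by rewrite -real_normK ?num_real// ler_pXn2r ?nnegrE// (le_trans _ (Me i j)).
by rewrite !sumr_const !card_ord -mulrnA mulr_natl mulnC.
Qed.

Lemma frobE m n (M : 'M[R]_(m, n)) : frob M = \tr (M^T *m M).
Proof.
rewrite /frob exchange_big; apply: eq_bigr => i _; rewrite mxE.
by apply: eq_bigr => j _; rewrite mxE expr2.
Qed.

Lemma frobT m n (M : 'M[R]_(m, n)) : frob M^T = frob M.
Proof.
rewrite /frob exchange_big; apply: eq_bigr => i _.
by apply: eq_bigr => j _; rewrite mxE.
Qed.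

Lemma frob_orthl n (U M : 'M[R]_n) : U^T *m U = 1%:M -> frob (U *m M) = frob M.
Proof. by move=> UU; rewrite !frobE trmx_mul -mulmxA (mulmxA U^T) UU mul1mx. Qed.

Lemma frob_orthr n (U M : 'M[R]_n) : U *m U^T = 1%:M -> frob (M *m U) = frob M.
Proof. by move=> UU; rewrite -frobT trmx_mul frob_orthl ?frobT// trmxK. Qed.

Lemma frobD m n (M N : 'M[R]_(m, n)) : frob (M + N) <= 2 * (frob M + frob N).
Proof.
rewrite /frob -big_split mulr_sumr; apply: ler_sum => i _ /=.
rewrite -big_split mulr_sumr; apply: ler_sum => j _ /=.
by rewrite mxE; have := sqr_ge0 (M i j - N i j); rewrite sqrrB sqrrD; lra.
Qed.

Lemma posmx_near1 n (A : 'M[R]_n) (e : R) :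
  (forall i j, `|(A - 1%:M) i j| <= e) -> n%:R * e < 1 -> posmx A.
Proof.
move=> Ae ne x x0; have := posmx1 x0; rewrite mulmx1.
set q := (x *m x^T) 0 0 => q0.
rewrite -[A](subrK 1%:M) mulmxDr mulmxDl mulmx1 [ltRHS]mxE -/q.
suff : - (n%:R * e * q) <= (x *m (A - 1%:M) *m x^T) 0 0.
  have ne' : 0 < 1 - n%:R * e by lra.
  have := mulr_gt0 ne' q0. by lra.
have qE : q = \sum_i x 0 i ^+ 2.
  by rewrite /q mxE; apply: eq_bigr => i _; rewrite mxE expr2.
have -> : - (n%:R * e * q) =
    \sum_(j < n) \sum_(i < n) - (e / 2 * (x 0 i ^+ 2 + x 0 j ^+ 2)).
  transitivity (\sum_(j < n) - (e / 2 * (q + n%:R * x 0 j ^+ 2))).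
    rewrite sumrN -mulr_sumr big_split /= sumr_const card_ord -mulr_natl.
    by rewrite -mulr_sumr -qE; field.
  apply: eq_bigr => j _; rewrite sumrN -mulr_sumr big_split /= -qE.
  by rewrite sumr_const card_ord mulr_natl.
rewrite mxE; apply: ler_sum => j _; rewrite !mxE mulr_suml.
apply: ler_sum => i _; have := Ae i j; rewrite ler_norml => /andP[e1 e2].
set d := (A - 1%:M) i j in e1 e2 *.
(* d u v >= - e (u^2 + v^2) / 2, as (e - d) (u - v)^2 + (e + d) (u + v)^2 >= 0. *)
have h1 : 0 <= (e - d) * (x 0 i - x 0 j) ^+ 2 by rewrite mulr_ge0 ?sqr_ge0 ?subr_ge0.
have h2 : 0 <= (e + d) * (x 0 i + x 0 j) ^+ 2.
  by rewrite mulr_ge0 ?sqr_ge0// -[e]opprK addrC subr_ge0.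
by rewrite sqrrB sqrrD in h1 h2; lra.
Qed.

Lemma mx_powD n (A : 'M[R]_(n + n)) k l : mx_pow A (k + l) = mx_pow A k *m mx_pow A l.
Proof. by elim: k => [|k IH] /=; [rewrite mul1mx | rewrite IH mulmxA]. Qed.

Lemma orthogonal_pow n (A : 'M[R]_(n + n)) k :
  orthogonal_mx A -> orthogonal_mx (mx_pow A k).
Proof.
rewrite /orthogonal_mx => AA; elim: k => [|k IH] /=; first by rewrite trmx1 mulmx1.
by rewrite trmx_mul mulmxA -(mulmxA A) IH mulmx1.
Qed.

(** Since [P ^ 2 - Q ^ 2 = P (P - Q) + (P - Q) Q], doubling the exponent at most doubles
the distance of two orthogonal matrices. *)
Lemma frob_pow_dist n (A B : 'M[R]_(n + n)) m :
  orthogonal_mx A -> orthogonal_mx B ->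
  frob (mx_pow A (2 ^ m) - mx_pow B (2 ^ m)) <= 4 ^+ m * frob (A - B).
Proof.
move=> oA oB; elim: m => [|m IH]; first by rewrite expn0 /= !mulmx1 mul1r.
rewrite expnS mul2n -addnn !mx_powD.
set P := mx_pow A _ in IH *; set Q := mx_pow B _ in IH *.
have -> : P *m P - Q *m Q = P *m (P - Q) + (P - Q) *m Q.
  by rewrite mulmxBr mulmxBl addrA subrK.
apply: le_trans (frobD _ _) _.
have oP : P *m P^T = 1%:M by exact: orthogonal_pow.
have oQ : Q *m Q^T = 1%:M by exact: orthogonal_pow.
rewrite frob_orthl ?frob_orthr//; last exact: mulmx1C.
by rewrite exprS; lra.
Qed.

End Frobenius.

(** * Values of a homogeneous quasimorphism on curves *)

Section Uniqueness.
Variables (R : realType) (n : nat).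
Local Opaque smooth.
Variables (rho : SpTilde R n -> R) (D : R).
Hypothesis defect : forall g h, `|rho (g * h)%g - rho g - rho h| <= D.
Hypothesis hrho : homogeneous rho.
Local Notation r F := (rho (curve_class F)).
Implicit Types (F G : R -> 'M[R]_(n + n)).

Let qrho : quasimorphism rho. Proof. by exists D. Qed.

Let D0 : 0 <= D. Proof. by apply: le_trans (defect 1%g 1%g). Qed.

Lemma value_conj_pow0 F G k : sp_curve F -> sp_curve G ->
  (forall t, G 1 *m F t = mx_pow (F t) k.+2 *m G 1) -> r F = 0.
Proof.
move=> hF hG GF; apply: (homogeneous_conj_pow0 qrho hrho (h := curve_class G) (k := k)).
rewrite -curve_classJ// -curve_classX//; congr curve_class; apply/funext => t.
by rewrite GF -mulmxA mul_sp_inv ?mulmx1//; case: hG.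
Qed.

Lemma value_conj_inv0 F G : sp_curve F -> sp_curve G ->
  (forall t, G 1 *m F t *m sp_inv (G 1) = sp_inv (F t)) -> r F = 0.
Proof.
move=> hF hG GF; apply: (homogeneous_conj_inv0 qrho hrho (h := curve_class G)).
rewrite -curve_classJ// -curve_classV//; congr curve_class; exact/funext.
Qed.

Lemma value_mul F G H C1 C2 : sp_curve G -> sp_curve H ->
  (forall t, F t = G t *m H t) -> `|r G| <= C1 -> `|r H| <= C2 ->
  `|r F| <= C1 + C2 + D.
Proof.
move=> hG hH FE; have -> : F = fun t => G t *m H t by exact/funext.
rewrite curve_classM//; have := defect (curve_class G) (curve_class H).
rewrite !ler_norml => /andP[? ?] /andP[? ?] /andP[? ?].
by apply/andP; split; lra.
Qed.

(** It ends at [J0], so that [curve_classJ] allows conjugation by [J0]. *)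
Definition J0_curve (t : R) : 'M[R]_(n + n) :=
  block_mx (cos (t * (pi / 2)))%:M (- (sin (t * (pi / 2)))%:M)
           (sin (t * (pi / 2)))%:M (cos (t * (pi / 2)))%:M.

Lemma J0_curveP : sp_curve J0_curve.
Proof.
have sl : smooth (fun t : R => t * (pi / 2)).
  have -> : (fun t : R => t * (pi / 2)) = fun t => (pi / 2) * t.
    by apply/funext => t; rewrite mulrC.
  exact: (@smoothZl _ (pi / 2) id (@smooth_id R)).
have ss (f : R -> R) : smooth f -> smooth (fun t : R => (f (t * (pi / 2)))%:M : 'M[R]_n).
  by move=> sf; exact: smooth_scalar_mx (smooth_comp sf sl).
split.
- apply: smooth_block_mx;
    [exact: ss (@smooth_cos R) | | exact: ss (@smooth_sin R) | exact: ss (@smooth_cos R)].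
  by apply: smooth_oppmx; exact: ss (@smooth_sin R).
- move=> t; apply/symplectic_blockP.
  rewrite !tr_scalar_mx [(- _)^T]linearN /= !tr_scalar_mx !(mulNmx, mulmxN) -!scalar_mxM opprK.
  by rewrite ![sin _ * cos _]mulrC -!expr2 -raddfD /= cos2Dsin2.
- by rewrite /J0_curve mul0r cos0 sin0 raddf0 oppr0 -scalar_mx_block.
Qed.

Lemma J0_curve1 : J0_curve 1 = J0 R n.
Proof. by rewrite /J0_curve mul1r cos_pihalf sin_pihalf raddf0. Qed.

(** The inverse of a symmetric symplectic matrix is its conjugate by [J0]. *)
Lemma value_symmetric F : sp_curve F -> (forall t, (F t)^T = F t) -> r F = 0.
Proof.
move=> hF FT; apply: (value_conj_inv0 hF J0_curveP) => t.
rewrite J0_curve1 [in RHS]/sp_inv FT; congr (_ *m _).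
by apply: sp_inv_eq (J0_trJ0 R n); case: J0_curveP => _ /(_ 1); rewrite J0_curve1.
Qed.

Lemma gl_diag_curve (A : R -> 'M[R]_n) : smooth A -> A 0 = 1%:M ->
  (forall t, A t \in unitmx) -> sp_curve (fun t => gl_diag (A t)).
Proof.
move=> sA A0 uA; split; last by rewrite A0 gl_diag1.
  apply: smooth_block_mx; [exact: sA | exact: smooth_cst | exact: smooth_cst |].
  by apply: smooth_trmx; exact: smooth_invmx.
by move=> t; exact: gl_diag_symplectic.
Qed.

Lemma dilation_unit (E : 'M[R]_n) (s : R) : E *m E = E -> 0 < 1 + s ->
  1%:M + s *: E \in unitmx.
Proof.
move=> EE s0; have : (1%:M + s *: E) *m (1%:M - (s / (1 + s)) *: E) = 1%:M.
  rewrite mulmxDl mul1mx mulmxBr mulmx1 -scalemxAr -scalemxAl EE scalerA.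
  rewrite -addrA -[RHS]addr0 -scaleNr -scalerBl -scalerDl; congr (_ + _).
  by rewrite (_ : _ + _ = 0) ?scale0r//; field; rewrite gt_eqF.
by case/mulmx1_unit.
Qed.

(** It ends at [gl_diag (1 + E)], so that [curve_classJ] allows conjugation by that matrix. *)
Lemma dilation_curve (E : 'M[R]_n) : E *m E = E ->
  sp_curve (fun t => gl_diag (1%:M + (t ^+ 2) *: E)).
Proof.
move=> EE; apply: gl_diag_curve.
- apply: smoothD; first exact: smooth_cst.
  apply: smooth_scalemx; last exact: smooth_cst.
  exact: (smoothM (@smooth_id R) (@smooth_id R)).
- by rewrite expr0n scale0r addr0.
- by move=> t; apply: dilation_unit => //; rewrite ltr_pwDl ?sqr_ge0.
Qed.

Lemma upper_shear_curve (B : R -> 'M[R]_n) : smooth B -> B 0 = 0 ->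
  (forall t, (B t)^T = B t) -> sp_curve (fun t => upper_shear (B t)).
Proof.
move=> sB B0 BT; split.
- by apply: smooth_block_mx; [exact: smooth_cst | exact: sB | exact: smooth_cst ..].
- by move=> t; exact: upper_shear_symplectic.
- by rewrite /upper_shear B0 -scalar_mx_block.
Qed.

Lemma lower_shear_curve (B : R -> 'M[R]_n) : smooth B -> B 0 = 0 ->
  (forall t, (B t)^T = B t) -> sp_curve (fun t => lower_shear (B t)).
Proof.
move=> sB B0 BT; split.
- apply: smooth_block_mx;
    [exact: smooth_cst | exact: smooth_cst | exact: sB | exact: smooth_cst].
- by move=> t; exact: lower_shear_symplectic.
- by rewrite /lower_shear B0 -scalar_mx_block.
Qed.

Lemma mx_pow_upper_shear (B : 'M[R]_n) k : mx_pow (upper_shear B) k = upper_shear (B *+ k).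
Proof.
elim: k => [|k /= ->]; first by rewrite /= /upper_shear mulr0n -scalar_mx_block.
by rewrite upper_shearD mulrSr.
Qed.

Lemma gl_diag2 : gl_diag (1%:M + 1 ^+ 2 *: 1%:M : 'M[R]_n) =
  block_mx 2%:M 0 0 (2^-1)%:M.
Proof.
rewrite expr1n scale1r /gl_diag -raddfD /=; congr block_mx.
by rewrite invmx_scalar tr_scalar_mx.
Qed.

(** Dilating by the factor 2 multiplies a shear by 4, that is, raises it to the
fourth power. *)
Lemma value_upper_shear (B : R -> 'M[R]_n) : smooth B -> B 0 = 0 ->
  (forall t, (B t)^T = B t) -> r (fun t => upper_shear (B t)) = 0.
Proof.
move=> sB B0 BT.
apply: (@value_conj_pow0 _ _ 2 (upper_shear_curve sB B0 BT) (dilation_curve (mulmx1 1%:M))) => t.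
rewrite mx_pow_upper_shear gl_diag2 /upper_shear !mulmx_block !mxs.
rewrite mul_scalar_mx mul_mx_scalar -[B t *+ _]scaler_nat scalerA; congr block_mx.
by congr (_ *: _); field.
Qed.

Lemma value_lower_shear (B : R -> 'M[R]_n) : smooth B -> B 0 = 0 ->
  (forall t, (B t)^T = B t) -> r (fun t => lower_shear (B t)) = 0.
Proof.
move=> sB B0 BT.
have hU : sp_curve (fun t => upper_shear (- B t)).
  apply: upper_shear_curve; [exact: smooth_oppmx | by rewrite B0 oppr0 |].
  by move=> t; rewrite linearN /= BT.
have -> : (fun t => lower_shear (B t)) =
    fun t => J0_curve 1 *m upper_shear (- B t) *m sp_inv (J0_curve 1).
  apply/funext => t; rewrite J0_curve1 /J0 sp_inv_block /lower_shear /upper_shear.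
  rewrite !mulmx_block !(oppr0, mxs, trmx0, trmx1, linearN) /=.
  by rewrite !(mulNmx, mulmxN, trmx1, opprK, mxs, oppr0).
rewrite curve_classJ//; last exact: J0_curveP.
rewrite homogeneousJ//; apply: value_upper_shear.
- exact: smooth_oppmx.
- by rewrite B0 oppr0.
- by move=> t; rewrite linearN /= BT.
Qed.

(** As [E N = N] and [N E = 0], conjugation by [1 + E] doubles [N], that is, squares
[1 + N]. *)
Lemma value_unip1 (E : 'M[R]_n) (N : R -> 'M[R]_n) :
  E *m E = E -> smooth N -> N 0 = 0 ->
  (forall t, E *m N t = N t) -> (forall t, N t *m E = 0) ->
  r (fun t => gl_diag (1%:M + N t)) = 0.
Proof.
move=> EE sN N0 EN NE.
have u1 t : 1%:M + N t \in unitmx by apply: sqr0_unit; exact: unip_sqr0 (EN t) (NE t).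
have hN : sp_curve (fun t => gl_diag (1%:M + N t)).
  apply: gl_diag_curve; [|by rewrite N0 addr0 | exact: u1].
  by apply: smoothD; [exact: smooth_cst | exact: sN].
apply: (@value_conj_pow0 _ _ 0 hN (dilation_curve EE)) => t /=.
have uE : 1%:M + 1 ^+ 2 *: E \in unitmx.
  by apply: dilation_unit => //; rewrite expr1n addr_gt0.
rewrite mulmx1 -!gl_diagM ?unitmx_mul ?u1//; congr gl_diag.
have NN := unip_sqr0 (EN t) (NE t).
have -> : (1%:M + N t) *m (1%:M + N t) = 1%:M + N t + N t.
  by rewrite mulmxDl mulmxDr !mxs mulmxDr NN !mxs.
rewrite expr1n scale1r.
have -> : (1%:M + E) *m (1%:M + N t) = 1%:M + N t + (E + N t).
  by rewrite mulmxDl mul1mx mulmxDr mulmx1 EN.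
have -> : (1%:M + N t + N t) *m (1%:M + E) = 1%:M + N t + N t + E.
  by rewrite mulmxDr mulmx1 !mulmxDl mul1mx !NE !addr0.
by rewrite addrA addrAC.
Qed.

Lemma value_unip k (A : R -> 'M[R]_n) : unip_curve k A ->
  `|r (fun t => gl_diag (A t))| <= k%:R * D.
Proof.
elim=> [|{}k E N {}A EE sN N0 EN NE uA IH].
  under eq_fun do rewrite gl_diag1; rewrite curve_class1 homogeneous1//.
  by rewrite normr0 mul0r.
have uN t : 1%:M + N t \in unitmx by apply: sqr0_unit; exact: unip_sqr0 (EN t) (NE t).
have uA' := unip_curve_unit uA.
have hA : sp_curve (fun t => gl_diag (A t)).
  apply: gl_diag_curve; [exact: unip_curve_smooth uA | exact: unip_curve0 uA | exact: uA'].
have hN : sp_curve (fun t => gl_diag (1%:M + N t)).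
  apply: gl_diag_curve; [|by rewrite N0 addr0 | exact: uN].
  by apply: smoothD; [exact: smooth_cst | exact: sN].
have := @value_mul (fun t => gl_diag ((1%:M + N t) *m A t)) _ _ 0 _ hN hA _ _ IH.
rewrite add0r -natr1 mulrDl mul1r; apply; first by move=> t; rewrite gl_diagM.
by rewrite (value_unip1 EE)// normr0.
Qed.

Lemma value_diag (d : R -> 'rV[R]_n) : smooth d -> d 0 = const_mx 1 ->
  (forall t j, 0 < d t 0 j) ->
  sp_curve (fun t => gl_diag (diag_mx (d t))) /\
  r (fun t => gl_diag (diag_mx (d t))) = 0.
Proof.
move=> sd d0 dp.
have ud t : diag_mx (d t) \in unitmx.
  rewrite unitmxE det_diag unitfE prodf_seq_neq0; apply/allP => j _.
  by rewrite /= gt_eqF.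
have hd : sp_curve (fun t => gl_diag (diag_mx (d t))).
  apply: gl_diag_curve; [exact: smooth_diag_mx | by rewrite d0 diag_const_mx | exact: ud].
split=> //; apply: value_symmetric => // t.
by rewrite /gl_diag tr_block_mx !trmx0 !trmx_inv !tr_diag_mx.
Qed.

(** The constants [du_bound], [gl_bound] and [pos_bound] are what [value_mul] yields; it
matters only that they do not depend on the curve. *)
Definition du_bound : R := 0 + n%:R * D + D.

Lemma value_du (d : R -> 'rV[R]_n) U : unip_curve n U ->
  smooth d -> d 0 = const_mx 1 -> (forall t j, 0 < d t 0 j) ->
  sp_curve (fun t => gl_diag (diag_mx (d t) *m U t)) /\
  `|r (fun t => gl_diag (diag_mx (d t) *m U t))| <= du_bound.
Proof.
move=> uU sd d0 dp; have [hd rd] := value_diag sd d0 dp.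
have uU' := unip_curve_unit uU.
have ud t : diag_mx (d t) \in unitmx.
  rewrite unitmxE det_diag unitfE prodf_seq_neq0; apply/allP => j _.
  by rewrite /= gt_eqF.
have hU : sp_curve (fun t => gl_diag (U t)).
  apply: gl_diag_curve; [exact: unip_curve_smooth uU | exact: unip_curve0 uU | exact: uU'].
have M t : gl_diag (diag_mx (d t) *m U t) = gl_diag (diag_mx (d t)) *m gl_diag (U t).
  by rewrite gl_diagM.
split; first by have := sp_curveM hd hU; under eq_fun do rewrite -M.
apply: (value_mul hd hU M); last exact: value_unip.
by rewrite rd normr0.
Qed.

Definition gl_bound : R := n%:R * D + du_bound + D.

Lemma value_ldu L (d : R -> 'rV[R]_n) U : unip_curve n L -> unip_curve n U ->
  smooth d -> d 0 = const_mx 1 -> (forall t j, 0 < d t 0 j) ->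
  `|r (fun t => gl_diag (L t *m diag_mx (d t) *m U t))| <= gl_bound.
Proof.
move=> uL uU sd d0 dp; have [hdU rdU] := value_du uU sd d0 dp.
have uL' := unip_curve_unit uL; have uU' := unip_curve_unit uU.
have ud t : diag_mx (d t) \in unitmx.
  rewrite unitmxE det_diag unitfE prodf_seq_neq0; apply/allP => j _.
  by rewrite /= gt_eqF.
have hL : sp_curve (fun t => gl_diag (L t)).
  apply: gl_diag_curve; [exact: unip_curve_smooth uL | exact: unip_curve0 uL | exact: uL'].
apply: (value_mul hL hdU _ (value_unip uL) rdU) => t.
by rewrite -mulmxA gl_diagM ?unitmx_mul ?ud ?uU'.
Qed.

Lemma value_posmx (A : R -> 'M[R]_n) : smooth A -> A 0 = 1%:M ->
  (forall t, posmx (A t)) -> `|r (fun t => gl_diag (A t))| <= gl_bound.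
Proof.
move=> sA A0 pA; have [L [d [U [uL uU [sd dp d0] AE _]]]] := smooth_LDU sA A0 pA.
rewrite (_ : (fun t => _) = fun t => gl_diag (L t *m diag_mx (d t) *m U t)).
  exact: value_ldu.
by apply/funext => t; rewrite AE.
Qed.

Lemma value_upper_block F C : sp_curve F -> (forall t, dlsubmx (F t) = 0) ->
  (forall t, ulsubmx (F t) \in unitmx) ->
  `|r (fun t => gl_diag (ulsubmx (F t)))| <= C -> `|r F| <= C + 0 + D.
Proof.
move=> hF F0 uF rC; have [sF aF F1] := hF; have [sA sB _ _] := smooth_submxs sF.
have fac t :
    (invmx (ulsubmx (F t)) *m ursubmx (F t))^T = invmx (ulsubmx (F t)) *m ursubmx (F t) /\
    F t = gl_diag (ulsubmx (F t)) *m
      upper_shear (invmx (ulsubmx (F t)) *m ursubmx (F t)).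
  have := aF t; rewrite -{1}[F t]submxK F0 => /(symplectic_upper_factor (uF t)).
  by rewrite -{1}(F0 t) submxK.
have sI := smooth_mulmx (smooth_invmx uF sA) sB.
move: F1; rewrite scalar_mx_block -[F 0]submxK => /eq_block_mx[A0 B0 _ _].
have b0 : invmx (ulsubmx (F 0)) *m ursubmx (F 0) = 0 by rewrite B0 mulmx0.
have bT t := proj1 (fac t).
apply: (@value_mul _ (fun t => gl_diag (ulsubmx (F t))) _ C 0 _ _ (fun t => proj2 (fac t)) rC).
- exact: gl_diag_curve.
- exact: (upper_shear_curve sI b0 bT).
- by rewrite (value_upper_shear sI b0 bT) normr0.
Qed.

Definition pos_bound : R := 0 + (gl_bound + 0 + D) + D.

(** Block elimination of the lower left corner, followed by [value_upper_block]. *)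
Lemma value_ulblock_pos F : sp_curve F -> (forall t, posmx (ulsubmx (F t))) ->
  `|r F| <= pos_bound.
Proof.
move=> hF pF; have uF t := posmx_unit (pF t).
have [sF aF F1] := hF; have [sA sB sC sD] := smooth_submxs sF.
pose E t := dlsubmx (F t) *m invmx (ulsubmx (F t)).
have sE : smooth E := smooth_mulmx sC (smooth_invmx uF sA).
move: F1; rewrite scalar_mx_block -[F 0]submxK => /eq_block_mx[A0 _ C0 _].
have E0 : E 0 = 0 by rewrite /E C0 mul0mx.
have ET t : (E t)^T = E t.
  have := aF t; rewrite -[F t]submxK => /symplectic_blockTP[h _ _].
  rewrite /E trmx_mul trmx_inv.
  apply: (can_inj (mulKmx (_ : (ulsubmx (F t))^T \in unitmx))); first by rewrite unitmx_tr.
  by rewrite mulKVmx ?unitmx_tr// !mulmxA h -mulmxA mulmxV// mulmx1.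
have hE := lower_shear_curve sE E0 ET.
have rE := value_lower_shear sE E0 ET.
pose K t := sp_inv (lower_shear (E t)) *m F t.
have hK : sp_curve K := sp_curveM (sp_curveV hE) hF.
have KE t : K t = block_mx (ulsubmx (F t)) (ursubmx (F t)) 0
    (drsubmx (F t) - E t *m ursubmx (F t)).
  rewrite /K -{1}[F t]submxK /lower_shear sp_inv_block.
  rewrite !(trmx0, trmx1, oppr0) mulmx_block !mxs ET !mulNmx.
  by rewrite /E mulmxKV// addNr addrC.
apply: (value_mul hE hK); last 1 first.
- apply: value_upper_block => //; try by move=> t; rewrite KE ?block_mxKdl ?block_mxKul.
  under eq_fun do rewrite KE block_mxKul; exact: value_posmx.
- by move=> t; rewrite /K mulmxA mul_sp_inv ?mul1mx//; exact: lower_shear_symplectic.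
- by rewrite rE normr0.
Qed.

(** The powers of [a] and [b] with exponent [2 ^ m] still differ by a curve [c] close to
the identity, on which the value is at most [pos_bound]. As the value is homogeneous,
[2 ^ m * (r a - r b)] is then at most [pos_bound + D]. *)
Lemma value_close a b m : sp_curve a -> sp_curve b ->
  (forall t, orthogonal_mx (a t)) -> (forall t, orthogonal_mx (b t)) ->
  pos_bound + D < 2 ^+ m ->
  (forall t, 4 ^+ m * frob (a t - b t) <= n.+1%:R^-1 ^+ 2) ->
  `|r a - r b| < 1.
Proof.
move=> ha hb oa ob large close.
have hak := sp_curveX (2 ^ m) ha; have hbk := sp_curveX (2 ^ m) hb.
pose c t := mx_pow (a t) (2 ^ m) *m sp_inv (mx_pow (b t) (2 ^ m)).
have hc : sp_curve c := sp_curveM hak (sp_curveV hbk).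
have cE t : sp_inv (mx_pow (b t) (2 ^ m)) = (mx_pow (b t) (2 ^ m))^T.
  by apply: sp_inv_orthogonal; [case: hbk => _ /(_ t) | exact: orthogonal_pow].
have near1 t : frob (c t - 1%:M) <= n.+1%:R^-1 ^+ 2.
  have oB : mx_pow (b t) (2 ^ m) *m (mx_pow (b t) (2 ^ m))^T = 1%:M by exact: orthogonal_pow.
  have -> : c t - 1%:M =
      (mx_pow (a t) (2 ^ m) - mx_pow (b t) (2 ^ m)) *m (mx_pow (b t) (2 ^ m))^T.
    by rewrite mulmxBl oB /c cE.
  rewrite frob_orthr; last by rewrite trmxK; exact: mulmx1C.
  exact: le_trans (frob_pow_dist m (oa t) (ob t)) (close t).
have rc : `|r c| <= pos_bound.
  apply: value_ulblock_pos => // t; apply: (@posmx_near1 _ _ _ n.+1%:R^-1).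
    move=> i j; have -> : (ulsubmx (c t) - 1%:M) i j = (c t - 1%:M) (lshift n i) (lshift n j).
      by rewrite !mxE eq_lshift.
    rewrite -[leRHS]gtr0_norm ?invr_gt0// -ler_sqr ?nnegrE// !real_normK ?num_real//.
    exact: le_trans (frob_ge_entry _ _ _) (near1 t).
  by rewrite ltr_pdivrMr// mul1r ltr_nat.
have := defect (curve_class c) (curve_class (fun t => mx_pow (b t) (2 ^ m))).
rewrite -curve_classM//.
have -> : (fun t => c t *m mx_pow (b t) (2 ^ m)) = fun t => mx_pow (a t) (2 ^ m).
  by apply/funext => t; rewrite /c -mulmxA mul_sp_invl ?mulmx1//; case: hbk.
rewrite !curve_classX// !hrho natrX => h.
have k0 : 0 < 2 ^+ m :> R by rewrite exprn_gt0.
rewrite -(ltr_pM2l k0) mulr1 -{1}[2 ^+ m]gtr0_norm// -normrM mulrBr.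
apply: le_lt_trans large; move: h rc; rewrite !ler_norml.
by move=> /andP[? ?] /andP[? ?]; apply/andP; split; lra.
Qed.

(** This holds for a difference of two solutions, whose values over the unitary group are
integers. *)
Hypothesis small_unitary0 : forall F, sp_curve F -> orthogonal_mx (F 1) ->
  `|r F| < 1 -> r F = 0.

(** Shrink a unitary curve to its origin in small steps: by [value_close] the
value changes by less than 1 at each step, hence remains 0. *)
Lemma value_unitary F : sp_curve F -> (forall t, orthogonal_mx (F t)) -> r F = 0.
Proof.
move=> hF oF; have [sF _ F0] := hF.
have [m large] : exists m, pos_bound + D < 2 ^+ m.
  have b0 : 0 <= pos_bound + D by rewrite /pos_bound /gl_bound /du_bound !addr_ge0// mulr_ge0.
  exists (Num.bound (pos_bound + D)); apply: lt_le_trans (archi_boundP b0) _.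
  by rewrite -natrX ler_nat ltnW// ltn_expl.
(* e is chosen so that the entrywise bound e gives the Frobenius bound of value_close. *)
pose e : R := n.+1%:R^-1 / (2 ^+ m * (n + n).+1%:R).
have e0 : 0 < e by rewrite divr_gt0 ?invr_gt0// mulr_gt0// exprn_gt0.
have [d d0 hd] := heine (@segment_compact R 0 1) (smooth_continuous sF) e0.
pose N := (Num.bound d^-1).+1.
have Nd : N%:R^-1 < d.
  rewrite -[d]invrK ltf_pV2 ?posrE ?invr_gt0//.
  apply: lt_le_trans (archi_boundP (ltW _)) _; first by rewrite invr_gt0.
  by rewrite ler_nat.
pose G j t := F (j%:R / N%:R * ramp t).
have hG j : sp_curve (G j).
  apply: (@sp_curve_comp _ _ F (fun t => j%:R / N%:R * ramp t)) => //.
    exact: (@smoothZl _ (j%:R / N%:R) _ (@smooth_ramp R)).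
  by rewrite ramp0 mulr0.
have step j : (j <= N)%N -> r (G j) = 0.
  elim: j => [_|j IH jN].
    have -> : G 0%N = fun=> 1%:M by apply/funext => t; rewrite /G !mul0r F0.
    by rewrite curve_class1 homogeneous1.
  apply: (small_unitary0 (hG _) (oF _)); rewrite -[r (G j.+1)]subr0 -(IH (ltnW jN)).
  apply: (value_close (hG _) (hG _) (fun t => oF _) (fun t => oF _) large) => t.
  have /andP[r0 r1] := ramp_itv t.
  have close i k : `|(G j.+1 t - G j t) i k| <= e.
    rewrite !mxE ltW//; apply: mx_norm_entry; apply: hd.
      have q0 : 0 <= j.+1%:R / N%:R :> R by rewrite divr_ge0.
      have q1 : j.+1%:R / N%:R <= 1 :> R by rewrite ler_pdivrMr// mul1r ler_nat.
      by rewrite /= in_itv /= (mulr_ge0 q0 r0) mulr_ile1.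
    rewrite -ball_normE /= -mulrBl -mulrBl -natrB ?subSnn//.
    have dn : 0 <= N%:R^-1 * ramp t by apply: mulr_ge0 r0; rewrite invr_ge0.
    rewrite mul1r ger0_norm//; apply: le_lt_trans Nd.
    by rewrite ler_piMr.
  apply: le_trans (_ : 4 ^+ m * (((n + n) * (n + n))%:R * e ^+ 2) <= _).
    by rewrite ler_wpM2l ?exprn_ge0// frob_le.
  have -> : 4 ^+ m = 2 ^+ m * 2 ^+ m :> R by rewrite -exprMn -natrM.
  have p0 : 0 < 2 ^+ m :> R by rewrite exprn_gt0.
  have -> : 2 ^+ m * 2 ^+ m * (((n + n) * (n + n))%:R * e ^+ 2) =
     n.+1%:R^-1 ^+ 2 * ((n + n)%:R / (n + n).+1%:R) ^+ 2.
    rewrite /e natrM; field.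
    by rewrite !gt_eqF.
  by rewrite ler_piMr ?sqr_ge0// exprn_ile1// ?divr_ge0// ler_pdivrMr// mul1r ler_nat.
rewrite -curve_class_ramp//; have := step N (leqnn _).
by rewrite /G mulfV ?pnatr_eq0//; under eq_fun do rewrite mul1r.
Qed.

(** The first [n] columns span a Lagrangian, with Gram matrix [G]. A smooth triangular
square root [Q] of [G], from its LDU factorization, makes them orthonormal: they become
the first columns of a unitary curve [T], and what remains is block triangular. *)
Lemma value_bounded F : sp_curve F -> `|r F| <= 0 + (du_bound + 0 + D) + D.
Proof.
move=> hF; have [sF aF F1] := hF; have [sA sB sC sD] := smooth_submxs sF.
pose A t := ulsubmx (F t); pose C t := dlsubmx (F t).
pose G t := (A t)^T *m A t + (C t)^T *m C t.
have sG : smooth G.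
  by apply: smoothD;
    [exact: smooth_mulmx (smooth_trmx sA) sA | exact: smooth_mulmx (smooth_trmx sC) sC].
have AC t : (A t)^T *m C t = (C t)^T *m A t.
  by have := aF t; rewrite -{1}[F t]submxK => /symplectic_blockTP[].
have AD t : (A t)^T *m drsubmx (F t) - (C t)^T *m ursubmx (F t) = 1%:M.
  by have := aF t; rewrite -{1}[F t]submxK => /symplectic_blockTP[].
have pG t : posmx (G t).
  apply: posmx_gram => x Ax Cx.
  by rewrite -[x]mulmx1 -(AD t) mulmxBr !mulmxA Ax Cx !mul0mx subrr.
move: F1; rewrite scalar_mx_block -[F 0]submxK => /eq_block_mx[A0 _ C0 _].
have G0 : G 0 = 1%:M by rewrite /G /A /C A0 C0 trmx1 trmx0 !mxs.
have [L [d [U [uL uU [sd dp d0] GE LU]]]] := smooth_LDU sG G0 pG.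
have GT t : (G t)^T = G t by rewrite /G linearD /= !trmx_mul !trmxK.
pose s t : 'rV[R]_n := map_mx Num.sqrt (d t).
have ss : smooth s.
  apply/smooth_mxP => i j; under eq_fun do rewrite mxE.
  by rewrite (ord1 i); apply: smooth_sqrt; [move=> t; exact: dp | exact: smooth_mx_entry].
have s0 : s 0 = const_mx 1 by apply/matrixP => i j; rewrite !mxE d0 mxE sqrtr1.
have sp t j : 0 < s t 0 j by rewrite mxE sqrtr_gt0.
pose Q t := diag_mx (s t) *m U t.
have sQ : smooth Q := smooth_mulmx (smooth_diag_mx ss) (unip_curve_smooth uU).
have QQ t : (Q t)^T *m Q t = G t.
  rewrite /Q trmx_mul tr_diag_mx GE (LU GT) !mulmxA; congr (_ *m _).
  rewrite -!mulmxA mulmx_diag; congr (_ *m diag_mx _).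
  by apply/matrixP => i j; rewrite !mxE (ord1 i) -expr2 sqr_sqrtr// ltW.
have uQ t : Q t \in unitmx.
  have : (Q t)^T *m Q t \in unitmx by rewrite QQ posmx_unit.
  by rewrite unitmx_mul => /andP[].
have Q0 : Q 0 = 1%:M by rewrite /Q s0 diag_const_mx (unip_curve0 uU) mulmx1.
have QE t : Q t = diag_mx (s t) *m U t by [].
clearbody Q.
pose X t := A t *m invmx (Q t); pose Y t := C t *m invmx (Q t).
have sX : smooth X := smooth_mulmx sA (smooth_invmx uQ sQ).
have sY : smooth Y := smooth_mulmx sC (smooth_invmx uQ sQ).
have QX t : X t *m Q t = A t by rewrite /X mulmxKV.
have QY t : Y t *m Q t = C t by rewrite /Y mulmxKV.
have X0 : X 0 = 1%:M by rewrite /X /A A0 Q0 invmx1 mulmx1.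
have Y0 : Y 0 = 0 by rewrite /Y /C C0 mul0mx.
clearbody X Y.
have cancelQ (M : R -> 'M[R]_n) (N : 'M[R]_n) t :
    (Q t)^T *m M t *m Q t = (Q t)^T *m N *m Q t -> M t = N.
  move=> /(can_inj (mulmxK (uQ t))).
  by apply: (can_inj (mulKmx _)); rewrite unitmx_tr.
have gramQ (M N : R -> 'M[R]_n) t :
    (Q t)^T *m ((M t)^T *m N t) *m Q t = (M t *m Q t)^T *m (N t *m Q t).
  by rewrite trmx_mul !mulmxA.
have XX t : (X t)^T *m X t + (Y t)^T *m Y t = 1%:M.
  apply: (cancelQ (fun t => (X t)^T *m X t + (Y t)^T *m Y t)).
  by rewrite mulmx1 QQ mulmxDr mulmxDl !gramQ QX QY.
have XY t : (X t)^T *m Y t = (Y t)^T *m X t.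
  apply: (cancelQ (fun t => (X t)^T *m Y t)).
  by rewrite !gramQ QX QY AC.
pose T t := block_mx (X t) (- Y t) (Y t) (X t).
have TT t : (T t)^T *m T t = 1%:M.
  rewrite /T tr_block_mx [(- _)^T]linearN /= mulmx_block !(mulNmx, mulmxN, opprK).
  by rewrite XX XY !addNr [_ + (X t)^T *m X t]addrC XX -scalar_mx_block.
have oT t : orthogonal_mx (T t) by exact: mulmx1C.
have aT t : symplectic (T t).
  rewrite -[T t]trmxK; apply: symplecticT; rewrite /T tr_block_mx [(- _)^T]linearN /=.
  apply/symplectic_blockP; rewrite ![(- _)^T]linearN /= !trmxK.
  by rewrite !(mulNmx, mulmxN, opprK) XX XY.
have hT : sp_curve T.
  split; [| exact: aT |]; last first.
    by rewrite /T X0 Y0 oppr0 -scalar_mx_block.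
  by apply: smooth_block_mx; [exact: sX | exact: smooth_oppmx | exact: sY | exact: sX].
pose K t := sp_inv (T t) *m F t.
have hK : sp_curve K := sp_curveM (sp_curveV hT) hF.
have KE t : ulsubmx (K t) = Q t /\ dlsubmx (K t) = 0.
  have -> : K t = (T t)^T *m F t by rewrite /K sp_inv_orthogonal.
  rewrite -[F t]submxK /T tr_block_mx [(- _)^T]linearN /= mulmx_block.
  rewrite block_mxKul block_mxKdl.
  rewrite -/(A t) -/(C t) -(QX t) -(QY t) !mulmxA mulNmx mulNmx -XY addNr.
  by rewrite -mulmxDl XX mul1mx.
apply: (value_mul hT hK).
- by move=> t; rewrite /K mulmxA mul_sp_inv// mul1mx.
- by rewrite value_unitary// normr0.
- apply: (value_upper_block hK (fun t => (KE t).2)).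
    by move=> t; rewrite (KE t).1.
  under eq_fun => t do rewrite (KE t).1 QE.
  by have [] := value_du uU ss s0 sp.
Qed.

End Uniqueness.

(** * Uniqueness *)

Section PhaseOfReals.
Variable R : realType.
Implicit Types x y : R.

Lemma cexp_turns x : cexp ((2 * pi)%:C%C * 'i%C * x%:C%C) =
  (cos (2 * pi * x) +i* sin (2 * pi * x))%C.
Proof.
have -> : ((2 * pi)%:C * 'i * x%:C = 0 +i* (2 * pi * x))%C.
  by apply/eqP; rewrite eq_complex /=; apply/andP; split; apply/eqP; ring.
by rewrite /cexp /= expR0 mul1r.
Qed.

Lemma cos_eq1 x : `|x| < 2 * pi -> cos x = 1 -> x = 0.
Proof.
move=> xpi; have -> : x = (x / 2) *+ 2 by rewrite -mulr_natr; field.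
rewrite cos_mulr2n => c1; have /eqP : sin (x / 2) ^+ 2 = 0.
  have := cos2Dsin2 (x / 2); rewrite mulr2n in c1; lra.
rewrite sqrf_eq0 => /eqP s0.
move: xpi; rewrite ltr_norml => /andP[xl xr].
have [xp|xn|x0] := ltgtP (x / 2) 0; last by rewrite x0 mul0rn.
  have : 0 < sin (- (x / 2)) by apply: sin_gt0_pi; apply/andP; split; lra.
  by rewrite sinN s0 oppr0 ltxx.
have : 0 < sin (x / 2) by apply: sin_gt0_pi; apply/andP; split; lra.
by rewrite s0 ltxx.
Qed.

Lemma same_phase x y : cos x = cos y -> sin x = sin y -> `|x - y| < 2 * pi -> x = y.
Proof.
move=> cxy sxy xy; apply/eqP; rewrite -subr_eq0; apply/eqP/cos_eq1 => //.
by rewrite cosB cxy sxy -!expr2 cos2Dsin2.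
Qed.

End PhaseOfReals.

Lemma descending_quasimorphism_unique (R : realType) n (mu nu : SpTilde R n -> R) :
  [/\ quasimorphism mu, homogeneous mu & descends_to_det mu] ->
  [/\ quasimorphism nu, homogeneous nu & descends_to_det nu] -> mu = nu.
Proof.
move=> [qm hm dm] [qn hn dn].
pose rho g := mu g - nu g.
have [D hD] : quasimorphism rho by exact: quasimorphismB.
have hrho : homogeneous rho by exact: homogeneousB.
have small F : sp_curve F -> orthogonal_mx (F 1) -> `|rho (curve_class F)| < 1 ->
    rho (curve_class F) = 0.
  move=> hF oF; rewrite -(@curve_classE _ _ (curve_path hF) F)//.
  have aF : symplectic (F 1) by case: hF.
  have E := symplectic_orthogonal_block aF oF.
  have := dn (curve_path hF) _ _ aF oF E; rewrite (dm (curve_path hF) _ _ aF oF E).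
  rewrite !cexp_turns /rho; set x := mu _; set y := nu _.
  move=> [cxy sxy] xy; have pi0 := pi_gt0 R.
  have p2 : 0 < 2 * pi :> R by rewrite mulr_gt0.
  have h : 2 * pi * x = 2 * pi * y.
    apply: same_phase => //.
    by rewrite -mulrBr normrM gtr0_norm// gtr_pMr.
  by rewrite (mulfI (lt0r_neq0 p2) h) subrr.
apply/funext => g; apply/eqP; rewrite -subr_eq0; apply/eqP.
apply: (@bounded_homogeneous0 _ _ rho hrho _ _ g) => h.
have [F hF ->] := curve_class_surj h.
exact: (value_bounded hD hrho small hF).
Qed.

(** * Continuous complex functions and their arguments *)

Section ComplexContinuity.
Variables (R : realType) (T : topologicalType).
Implicit Types f g : T -> R[i].

Definition ccontinuous f :=
  continuous (fun x => complex.Re (f x)) /\ continuous (fun x => complex.Im (f x)).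

Lemma ReIm_mul (z w : R[i]) :
  complex.Re (z * w) = complex.Re z * complex.Re w - complex.Im z * complex.Im w /\
  complex.Im (z * w) = complex.Re z * complex.Im w + complex.Im z * complex.Re w.
Proof. by case: z w => [a b] [c d]. Qed.

Lemma ReIm_add (z w : R[i]) :
  complex.Re (z + w) = complex.Re z + complex.Re w /\
  complex.Im (z + w) = complex.Im z + complex.Im w.
Proof. by case: z w => [a b] [c d]. Qed.

Lemma ccontinuous_cst (z : R[i]) : ccontinuous (fun=> z).
Proof. by split=> x; exact: cvg_cst. Qed.

Lemma ccontinuousD f g : ccontinuous f -> ccontinuous g ->
  ccontinuous (fun x => f x + g x).
Proof.
move=> [f1 f2] [g1 g2]; split=> x.
  under eq_fun do rewrite (ReIm_add _ _).1.
  by apply: cvgD; [exact: f1 | exact: g1].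
under eq_fun do rewrite (ReIm_add _ _).2.
by apply: cvgD; [exact: f2 | exact: g2].
Qed.

Lemma ccontinuousM f g : ccontinuous f -> ccontinuous g ->
  ccontinuous (fun x => f x * g x).
Proof.
move=> [f1 f2] [g1 g2]; split=> x.
  under eq_fun do rewrite (ReIm_mul _ _).1.
  by apply: cvgB; apply: cvgM;
    [exact: f1 | exact: g1 | exact: f2 | exact: g2].
under eq_fun do rewrite (ReIm_mul _ _).2.
by apply: cvgD; apply: cvgM;
  [exact: f1 | exact: g2 | exact: f2 | exact: g1].
Qed.

Lemma ccontinuous_sum (I : Type) (r : seq I) (P : pred I) (F : I -> T -> R[i]) :
  (forall i, ccontinuous (F i)) -> ccontinuous (fun t => \sum_(i <- r | P i) F i t).
Proof.
move=> cF; elim: r => [|i r IH].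
  rewrite (_ : (fun _ => _) = fun=> 0); first exact: ccontinuous_cst.
  by apply/funext => t; rewrite big_nil.
case Pi: (P i); last first.
  rewrite (_ : (fun _ => _) = fun t => \sum_(j <- r | P j) F j t) //.
  by apply/funext => t; rewrite big_cons Pi.
rewrite (_ : (fun _ => _) = fun t => F i t + \sum_(j <- r | P j) F j t).
  exact: (ccontinuousD (cF i) IH).
by apply/funext => t; rewrite big_cons Pi.
Qed.

Lemma ccontinuous_prod (I : Type) (r : seq I) (P : pred I) (F : I -> T -> R[i]) :
  (forall i, ccontinuous (F i)) -> ccontinuous (fun t => \prod_(i <- r | P i) F i t).
Proof.
move=> cF; elim: r => [|i r IH].
  rewrite (_ : (fun _ => _) = fun=> 1); first exact: ccontinuous_cst.
  by apply/funext => t; rewrite big_nil.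
case Pi: (P i); last first.
  rewrite (_ : (fun _ => _) = fun t => \prod_(j <- r | P j) F j t) //.
  by apply/funext => t; rewrite big_cons Pi.
rewrite (_ : (fun _ => _) = fun t => F i t * \prod_(j <- r | P j) F j t).
  exact: (ccontinuousM (cF i) IH).
by apply/funext => t; rewrite big_cons Pi.
Qed.

Definition ccontinuous_mx m n (M : T -> 'M[R[i]]_(m, n)) :=
  forall i j, ccontinuous (fun x => M x i j).

Lemma ccontinuous_mulmx m n p (M : T -> 'M[R[i]]_(m, n)) (N : T -> 'M[R[i]]_(n, p)) :
  ccontinuous_mx M -> ccontinuous_mx N -> ccontinuous_mx (fun x => M x *m N x).
Proof.
move=> cM cN i j; under eq_fun do rewrite mxE.
by apply: ccontinuous_sum => k; exact: ccontinuousM.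
Qed.

Lemma ccontinuous_det n (M : T -> 'M[R[i]]_n) :
  ccontinuous_mx M -> ccontinuous (fun x => \det (M x)).
Proof.
move=> cM; rewrite /determinant; apply: ccontinuous_sum => s.
apply: (ccontinuousM (ccontinuous_cst _)).
by apply: ccontinuous_prod => i; exact: cM.
Qed.

End ComplexContinuity.

Section Phase.
Variable R : realType.

(** The real number [a] is an argument of the nonzero complex number [z]. *)
Definition phase (z : R[i]) (a : R) :=
  exists2 m : R, 0 < m & z = m%:C%C * (cos a +i* sin a)%C.

Lemma phase1 : phase 1 0.
Proof. by exists 1 => //; rewrite cos0 sin0 mul1r. Qed.

Lemma phaseM z w a b : phase z a -> phase w b -> phase (z * w) (a + b).
Proof.
move=> [k k0 ->] [l l0 ->]; exists (k * l); first by rewrite mulr_gt0.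
rewrite cosD sinD; apply/eqP; rewrite eq_complex /=.
by apply/andP; split; apply/eqP; ring.
Qed.

Lemma phase_neq0 z a : phase z a -> z != 0.
Proof.
move=> [m m0 ->]; rewrite mulf_neq0//; first by rewrite eq_complex /= gt_eqF.
rewrite eq_complex /=; apply/negP => /andP[/eqP c0 /eqP s0].
by have := cos2Dsin2 a; rewrite c0 s0 expr0n addr0 => /eqP; rewrite eq_sym oner_eq0.
Qed.

Lemma phase_inj z a b : phase z a -> phase z b -> cos a = cos b /\ sin a = sin b.
Proof.
move=> [m m0 ->] [l l0] [h1 h2]; have := cos2Dsin2 a; have := cos2Dsin2 b.
move: h1 h2; rewrite !mul0r subr0 addr0 subr0 addr0 => h1 h2 hb ha.
have : m ^+ 2 = l ^+ 2.
  transitivity ((m * cos a) ^+ 2 + (m * sin a) ^+ 2).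
    by rewrite !exprMn -mulrDr ha mulr1.
  by rewrite h1 h2 !exprMn -mulrDr hb mulr1.
move=> /eqP; rewrite eqrXn2// ?ltW// => /eqP ml.
by split; apply: (mulfI (lt0r_neq0 m0)); rewrite ?h1 ?h2 ml.
Qed.

End Phase.

(** * Lifting of arguments over the unit square *)

Section Lifting.
Variable R : realType.
Implicit Types (z w : R[i]).

(** The retraction of the line onto [0, 1], in a form whose continuity is immediate. *)
Definition clamp (t : R) : R := (`|t| - `|t - 1| + 1) / 2.

Lemma clamp_itv t : 0 <= clamp t <= 1.
Proof.
rewrite /clamp; have [t0|t0] := ger0P t; have [t1|t1] := ger0P (t - 1);
  by apply/andP; split; lra.
Qed.

Lemma clamp_id t : 0 <= t <= 1 -> clamp t = t.
Proof.
move=> /andP[t0 t1]; rewrite /clamp ger0_norm// ler0_norm ?subr_le0//.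
by field.
Qed.

Lemma clamp0 : clamp 0 = 0. Proof. by rewrite clamp_id ?lexx ?ler01. Qed.
Lemma clamp1 : clamp 1 = 1. Proof. by rewrite clamp_id ?lexx ?ler01. Qed.

Lemma clamp_continuous : continuous clamp.
Proof.
move=> t; apply: cvgM; last exact: cvg_cst.
apply: cvgD; last exact: cvg_cst.
apply: cvgB; first exact: norm_continuous.
by apply: cvg_norm; apply: cvgB; [exact: cvg_id | exact: cvg_cst].
Qed.

Lemma phase_right_half z : 0 < complex.Re z ->
  phase z (atan (complex.Im z / complex.Re z)).
Proof.
case: z => a b /= a0; set u := b / a.
have s0 : 0 < Num.sqrt (1 + u ^+ 2) by rewrite sqrtr_gt0 ltr_pwDl// sqr_ge0.
exists (a * Num.sqrt (1 + u ^+ 2)); first by rewrite mulr_gt0.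
have sE : sin (atan u) = u * cos (atan u).
  by rewrite -{2}(atanK u) /tan mulfVK// cos_atan invr_eq0 gt_eqF.
rewrite sE cos_atan; apply/eqP; rewrite eq_complex /=.
apply/andP; split; apply/eqP; rewrite ?/u; field; rewrite !gt_eqF//.
Qed.

(** The angle from [z] to [w] is read off [w * conj z = qr + i qi] when that number lies in
the right half-plane. *)
Lemma phase_step z w a :
  let qr := complex.Re w * complex.Re z + complex.Im w * complex.Im z in
  let qi := complex.Im w * complex.Re z - complex.Re w * complex.Im z in
  0 < qr -> phase z a -> phase w (a + atan (qi / qr)).
Proof.
case: z w => [x y] [u v]; rewrite [complex.Re _]/= [complex.Im _]/=.
move=> qr qi q0 pz.
have pq := @phase_right_half (qr +i* qi)%C q0.
have zz : 0 < x ^+ 2 + y ^+ 2.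
  have := phase_neq0 pz; rewrite eq_complex /= negb_and => /orP[h|h].
    by rewrite ltr_pwDl ?sqr_ge0// lt0r sqrf_eq0 h sqr_ge0.
  by rewrite ltr_wpDl ?sqr_ge0// lt0r sqrf_eq0 h sqr_ge0.
have [m m0 []] := phaseM pz pq.
set c := cos _; set s := sin _; rewrite !(mul0r, subr0, addr0) => E1 E2.
exists (m / (x ^+ 2 + y ^+ 2)); first by rewrite divr_gt0.
apply/eqP; rewrite eq_complex /= -/c -/s !(mul0r, subr0, addr0).
apply/andP; split; apply/eqP; rewrite mulrAC -?E1 -?E2 /qr /qi /=.
  by field; exact: lt0r_neq0.
by field; exact: lt0r_neq0.

Qed.

(** The segment from the origin to [x] is cut into [N] pieces so short that the
argument turns by less than a right angle on each of them; the argument at [x] is the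
sum of these turns. *)
Lemma square_lift (f : R * R -> R[i]) :
  ccontinuous f -> (forall x, f x != 0) -> f (0, 0) = 1 ->
  exists th : R * R -> R, [/\ continuous th, th (0, 0) = 0 &
    forall x, 0 <= x.1 <= 1 -> 0 <= x.2 <= 1 -> phase (f x) (th x)].
Proof.
move=> [ca cb] f0 f1.
pose a x := complex.Re (f x); pose b x := complex.Im (f x).
pose m x := Num.sqrt (a x ^+ 2 + b x ^+ 2).
have m0 x : 0 < m x.
  have := f0 x; rewrite sqrtr_gt0 eq_complex /= negb_and -/(a x) -/(b x) => /orP[h|h].
    by rewrite ltr_pwDl ?sqr_ge0// lt0r sqrf_eq0 h sqr_ge0.
  by rewrite ltr_wpDl ?sqr_ge0// lt0r sqrf_eq0 h sqr_ge0.
have mm x : m x ^+ 2 = a x ^+ 2 + b x ^+ 2 by rewrite sqr_sqrtr// addr_ge0// sqr_ge0.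
have cm : continuous m.
  move=> x.
  have h : a y ^+ 2 + b y ^+ 2 @[y --> x] --> a x ^+ 2 + b x ^+ 2.
    by apply: cvgD; [exact: (cvgM (ca x) (ca x)) | exact: (cvgM (cb x) (cb x))].
  exact: (cvg_comp _ _ h (@sqrt_continuous R _)).
have cu : continuous (fun x => a x / m x).
  by move=> x; apply: cvgM; [exact: ca | apply: cvgV; [rewrite gt_eqF | exact: cm]].
have cv : continuous (fun x => b x / m x).
  by move=> x; apply: cvgM; [exact: cb | apply: cvgV; [rewrite gt_eqF | exact: cm]].
have K : compact (`[0, 1]%classic `*` `[0, 1]%classic : set (R * R)).
  by apply: compact_setX; exact: segment_compact.
have half : 0 < 2^-1 :> R by rewrite invr_gt0.
have [d1 d10 h1] := heine K cu half.
have [d2 d20 h2] := heine K cv half.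
pose N := (Num.bound (d1^-1 + d2^-1)).+1.
have Npos : 0 < N%:R :> R by rewrite ltr0n.
have Nd : (N%:R^-1 < d1) /\ (N%:R^-1 < d2).
  have h : d1^-1 + d2^-1 < N%:R.
    apply: lt_le_trans (archi_boundP _) _; first by rewrite addr_ge0// invr_ge0 ltW.
    by rewrite ler_nat.
  have i1 : 0 < d1^-1 by rewrite invr_gt0.
  have i2 : 0 < d2^-1 by rewrite invr_gt0.
  by split; rewrite -[ltRHS]invrK ltf_pV2 ?posrE//; lra.
pose p (k : nat) (x : R * R) := (k%:R / N%:R * clamp x.1, k%:R / N%:R * clamp x.2).
have cp k : continuous (p k).
  move=> x.
  have c1 : clamp y.1 @[y --> x] --> clamp x.1.
    by apply: (cvg_comp _ _ (@cvg_fst _ _ (nbhs x.1) (nbhs x.2) _)); exact: clamp_continuous.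
  have c2 : clamp y.2 @[y --> x] --> clamp x.2.
    by apply: (cvg_comp _ _ (@cvg_snd _ _ (nbhs x.1) (nbhs x.2) _)); exact: clamp_continuous.
  exact: (cvg_pair (cvgM (cvg_cst _) c1) (cvgM (cvg_cst _) c2)).
pose qr k x := a (p k.+1 x) * a (p k x) + b (p k.+1 x) * b (p k x).
pose qi k x := b (p k.+1 x) * a (p k x) - a (p k.+1 x) * b (p k x).
have qr0 k x : (k < N)%N -> 0 < qr k x.
  move=> kN.
  have /andP[x0 x1] := clamp_itv x.1; have /andP[y0 y1] := clamp_itv x.2.
  have k0 : 0 <= k%:R / N%:R :> R by rewrite divr_ge0.
  have k1 : k%:R / N%:R <= 1 :> R by rewrite ler_pdivrMr// mul1r ler_nat ltnW.
  have Kp : (`[0, 1]%classic `*` `[0, 1]%classic : set (R * R)) (p k x).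
    by split; rewrite /= in_itv /= mulr_ge0//= mulr_ile1.
  have near1 (c d : R) : 0 <= c <= 1 -> N%:R^-1 < d ->
      `|k%:R / N%:R * c - k.+1%:R / N%:R * c| < d.
    move=> /andP[c0 c1]; apply: le_lt_trans; rewrite distrC -mulrBl -mulrBl -natrB// subSnn.
    have N0 : 0 <= N%:R^-1 :> R by rewrite invr_ge0.
    by rewrite mul1r ger0_norm ?mulr_ge0// ler_piMr.
  have bp (d : R) : N%:R^-1 < d -> ball (p k x) d (p k.+1 x).
    by move=> Nd'; split; rewrite -ball_normE /=; apply: near1; rewrite // clamp_itv.
  have := h1 _ _ Kp (bp _ Nd.1); have := h2 _ _ Kp (bp _ Nd.2).
  rewrite /qr -[a (p k.+1 x)](mulfVK (lt0r_neq0 (m0 (p k.+1 x)))).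
  rewrite -[b (p k.+1 x)](mulfVK (lt0r_neq0 (m0 (p k.+1 x)))).
  rewrite -[a (p k x)](mulfVK (lt0r_neq0 (m0 (p k x)))).
  rewrite -[b (p k x)](mulfVK (lt0r_neq0 (m0 (p k x)))).
  rewrite !mulfK ?lt0r_neq0//.
  have unit y : (a y / m y) ^+ 2 + (b y / m y) ^+ 2 = 1.
    by rewrite !expr_div_n -mulrDl -mm mulfV// expf_neq0// lt0r_neq0.
  have := unit (p k x); have := unit (p k.+1 x).
  have := m0 (p k x); have := m0 (p k.+1 x).
  set m1 := m (p k.+1 x); set m2 := m (p k x).
  set u1 := _ / m1; set v1 := b _ / m1; set u2 := a _ / m2; set v2 := b _ / m2.
  move=> p1 p2 e1 e2.
  rewrite !ltr_norml => /andP[? ?] /andP[? ?].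
  have -> : u1 * m1 * (u2 * m2) + v1 * m1 * (v2 * m2) = m1 * m2 * (u1 * u2 + v1 * v2) by ring.
  rewrite !mulr_gt0//.
  have hu : (u2 - u1) ^+ 2 < 1 / 4.
    have : 0 < (1/2 - (u2 - u1)) * (1/2 + (u2 - u1)) by rewrite mulr_gt0//; lra.
    by rewrite expr2; lra.
  have hv : (v2 - v1) ^+ 2 < 1 / 4.
    have : 0 < (1/2 - (v2 - v1)) * (1/2 + (v2 - v1)) by rewrite mulr_gt0//; lra.
    by rewrite expr2; lra.
  by rewrite !sqrrB in hu hv; lra.
exists (fun x => \sum_(k < N) atan (qi k x / qr k x)); split.
- move=> x; apply: cvg_big => [|k _]; first exact: add_continuous.
  have ka j : a (p j y) @[y --> x] --> a (p j x) by exact: (cvg_comp _ _ (cp j x) (ca (p j x))).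
  have kb j : b (p j y) @[y --> x] --> b (p j x) by exact: (cvg_comp _ _ (cp j x) (cb (p j x))).
  have kr : qr k y @[y --> x] --> qr k x.
    by apply: cvgD; [exact: (cvgM (ka _) (ka _)) | exact: (cvgM (kb _) (kb _))].
  have ki : qi k y @[y --> x] --> qi k x.
    by apply: cvgB; [exact: (cvgM (kb _) (ka _)) | exact: (cvgM (ka _) (kb _))].
  have qn : qr k x != 0 by rewrite gt_eqF// qr0.
  apply: (@continuous_cvg _ _ _ _ _ _ (@atan R)); first exact: continuous_atan.
  exact: (cvgM ki (cvgV qn kr)).
- have p0 j : p j (0, 0) = (0, 0) by rewrite /p /= clamp0 !mulr0.
  by rewrite big1// => k _; rewrite /qi !p0 [b _ * _]mulrC subrr mul0r atan0.
- move=> x x01 y01.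
  have ph j : (j <= N)%N -> phase (f (p j x)) (\sum_(k < j) atan (qi k x / qr k x)).
    elim: j => [_|j IH jN].
      by rewrite big_ord0 /p !mul0r f1; exact: phase1.
    rewrite big_ord_recr /=; apply: phase_step (IH (ltnW jN)).
    exact: qr0.
  have := ph N (leqnn _).
  by rewrite /p mulfV ?lt0r_neq0// !mul1r !clamp_id// -surjective_pairing.
Qed.


End Lifting.

(** * Winding of a complex curve *)

Section Winding.
Variable R : realType.
Implicit Types (f g : R -> R[i]) (F : R * R -> R[i]).

(** The argument starts from 0, so [f 0] has to be a positive real number. *)
Definition winding f (w : R) := exists th : R -> R,
  [/\ continuous th, th 0 = 0, th 1 = w & forall t, 0 <= t <= 1 -> phase (f t) (th t)].

(** Were the lifts distinct at time 1, their distance would by continuity take a value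
strictly between 0 and a full turn, where equality of phases fails. *)
Lemma lift_unique f (th eta : R -> R) : continuous th -> continuous eta ->
  th 0 = eta 0 ->
  (forall t, 0 <= t <= 1 -> phase (f t) (th t)) ->
  (forall t, 0 <= t <= 1 -> phase (f t) (eta t)) -> th 1 = eta 1.
Proof.
move=> cth ceta e0 pth peta; pose d t := th t - eta t.
have cd : continuous (fun t => `|d t|).
  by move=> t; apply: cvg_norm; apply: cvgB; [exact: cth | exact: ceta].
have d0 : d 0 = 0 by rewrite /d e0 subrr.
have pi0 := pi_gt0 R.
apply/eqP; rewrite -subr_eq0 -normr_eq0 -/(d 1); apply/negPn/negP => d1.
pose c := Num.min `|d 1| pi.
have c0 : 0 < c by rewrite /c lt_min pi0 lt0r d1 normr_ge0.
have [|t It tc] := @IVT R (fun t => `|d t|) 0 1 c ler01 (continuous_subspaceT cd).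
  rewrite d0 normr0 min_l// max_r// ltW//=.
  by rewrite /c ge_min lexx.
have It' : 0 <= t <= 1 by move: It; rewrite in_itv.
have [hc hs] := phase_inj (pth t It') (peta t It').
have E : th t = eta t.
  apply: same_phase => //; rewrite -/(d t) tc; apply: le_lt_trans (_ : pi < _).
    by rewrite /c ge_min lexx orbT.
  by lra.
by move: tc c0; rewrite /d E subrr normr0 => <-; rewrite ltxx.
Qed.

Lemma winding_unique f w v : winding f w -> winding f v -> w = v.
Proof.
move=> [th [cth th0 <- pth]] [eta [ceta eta0 <- peta]].
by apply: (lift_unique cth ceta _ pth peta); rewrite th0 eta0.
Qed.

Lemma winding_eq f g w : (forall t, 0 <= t <= 1 -> f t = g t) -> winding f w -> winding g w.
Proof.
by move=> fg [th [cth th0 th1 pth]]; exists th; split=> // t It; rewrite -fg//; exact: pth.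
Qed.

Lemma winding1 : winding (fun=> 1) 0.
Proof.
exists (fun=> 0); split=> //; first exact: cst_continuous.
by move=> t _; exact: phase1.
Qed.

Lemma windingM f g w v : winding f w -> winding g v ->
  winding (fun t => f t * g t) (w + v).
Proof.
move=> [th [cth th0 <- pth]] [eta [ceta eta0 <- peta]].
exists (fun t => th t + eta t); split=> //; last first.
- by move=> t It; apply: phaseM; [exact: pth | exact: peta].
- by rewrite th0 eta0 addr0.
- by move=> t; apply: cvgD; [exact: cth | exact: ceta].
Qed.

Lemma winding_endpoint f w : winding f w -> phase (f 1) w.
Proof. by move=> [th [_ _ <- pth]]; apply: pth; rewrite ler01 lexx. Qed.

Lemma ccontinuous_comp (S T : topologicalType) (f : T -> R[i]) (h : S -> T) :
  ccontinuous f -> continuous h -> ccontinuous (f \o h).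
Proof.
by move=> [f1 f2] ch; split=> x;
  [exact: (cvg_comp _ _ (ch x) (f1 _)) | exact: (cvg_comp _ _ (ch x) (f2 _))].
Qed.

Definition clamp2 (x : R * R) := (clamp x.1, clamp x.2).

Lemma clamp2_continuous : continuous clamp2.
Proof.
move=> x; have c1 : clamp y.1 @[y --> x] --> clamp x.1.
  by apply: (cvg_comp _ _ (@cvg_fst _ _ (nbhs x.1) (nbhs x.2) _)); exact: clamp_continuous.
have c2 : clamp y.2 @[y --> x] --> clamp x.2.
  by apply: (cvg_comp _ _ (@cvg_snd _ _ (nbhs x.1) (nbhs x.2) _)); exact: clamp_continuous.
exact: (cvg_pair c1 c2).
Qed.

Lemma slice1_continuous (t : R) : continuous (fun s : R => (s, t)).
Proof. by move=> s; exact: (cvg_pair cvg_id (cvg_cst t)). Qed.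

Lemma slice2_continuous (s : R) : continuous (fun t : R => (s, t)).
Proof. by move=> t; exact: (cvg_pair (cvg_cst s) cvg_id). Qed.

(** A continuous argument over the whole square restricts to one along each side: going
from [(0, 0)] to [(1, 1)] either way round gives the same total. *)
Lemma winding_square F g w0 w1 v : ccontinuous F ->
  (forall s t, 0 <= s <= 1 -> 0 <= t <= 1 -> F (s, t) != 0) ->
  (forall s, 0 <= s <= 1 -> F (s, 0) = 1) ->
  winding (fun t => F (0, t)) w0 -> winding (fun t => F (1, t)) w1 ->
  (forall s, 0 <= s <= 1 -> F (s, 1) = F (0, 1) * g s) -> winding g v ->
  w1 = w0 + v.
Proof.
move=> cF Fn F0 W0 W1 Fg [eta [ceta eta0 <- peta]].
have i0 : 0 <= (0 : R) <= 1 by rewrite lexx ler01.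
have i1 : 0 <= (1 : R) <= 1 by rewrite lexx ler01.
have [||| th [cth th00 pth]] := @square_lift R (F \o clamp2).
- by apply: ccontinuous_comp; last exact: clamp2_continuous.
- by move=> x; apply: Fn; exact: clamp_itv.
- by rewrite /clamp2 /= clamp0 F0.
have pth' s t : 0 <= s <= 1 -> 0 <= t <= 1 -> phase (F (s, t)) (th (s, t)).
  by move=> Is It; have := pth (s, t) Is It; rewrite /= /clamp2 /= !clamp_id.
have bottom s : 0 <= s <= 1 -> th (s, 0) = 0.
  move=> /andP[s0 s1].
  have c u : 0 <= u <= 1 -> 0 <= u * s <= 1.
    by move=> /andP[u0 u1]; rewrite mulr_ge0// mulr_ile1.
  have := @lift_unique (fun u => F (u * s, 0)) (fun u => th (u * s, 0)) (fun=> 0).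
  rewrite mul1r mul0r; apply=> //.
  - move=> u; have cs : (x * s, 0 : R) @[x --> u] --> (u * s, 0 : R).
      exact: (cvg_pair (cvgM cvg_id (cvg_cst s)) (cvg_cst _)).
    exact: (cvg_comp _ _ cs (cth _)).
  - exact: cst_continuous.
  - by move=> u Iu; apply: pth' => //; exact: c.
  - by move=> u Iu; rewrite F0; [exact: phase1 | exact: c].
have side s w : 0 <= s <= 1 -> winding (fun t => F (s, t)) w -> th (s, 1) = w.
  move=> Is W; apply: winding_unique W; exists (fun t => th (s, t)); split=> //.
  - by move=> t; exact: (cvg_comp _ _ (@slice2_continuous s t) (cth _)).
  - exact: bottom.
  - by move=> t It; exact: pth'.
rewrite -(side _ _ i1 W1) -(side _ _ i0 W0).
apply: (@lift_unique (fun s => F (s, 1)) (fun s => th (s, 1)) (fun s => th (0, 1) + eta s)).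
- by move=> s; exact: (cvg_comp _ _ (@slice1_continuous 1 s) (cth _)).
- by move=> s; apply: cvgD; [exact: cvg_cst | exact: ceta].
- by rewrite eta0 addr0.
- by move=> s Is; exact: pth'.
- by move=> s Is; rewrite Fg//; apply: phaseM; [exact: pth' | exact: peta].
Qed.

Lemma winding_exists f : ccontinuous f -> (forall t, f t != 0) -> f 0 = 1 ->
  exists w, winding f w.
Proof.
move=> cf fn f0.
have [||| th [cth th00 pth]] := @square_lift R (f \o snd).
- apply: ccontinuous_comp => // x; exact: cvg_snd.
- by move=> x; exact: fn.
- by rewrite /= f0.
exists (th (0, 1)), (fun t => th (0, t)); split=> //.
- by move=> t; exact: (cvg_comp _ _ (@slice2_continuous 0 t) (cth _)).
- by move=> t It; apply: (pth (0, t)); rewrite //= lexx ler01.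
Qed.

(** Linear factors [1 + s * l] with [|l| < 1] stay in the right half-plane. *)
Lemma winding_prod_unit_disk (ls : seq R[i]) : (forall l, l \in ls -> `|l| < 1) ->
  exists2 v, winding (fun s => \prod_(l <- ls) (1 + s%:C%C * l)) v &
    `|v| <= (size ls)%:R * (pi / 2).
Proof.
elim: ls => [_|l ls IH hl].
  exists 0; last by rewrite normr0 mul0r.
  by under eq_fun do rewrite big_nil; exact: winding1.
have [|v Wv vb] := IH; first by move=> x xl; apply: hl; rewrite inE xl orbT.
have l1 : -1 < complex.Re l.
  have := hl l (mem_head _ _); case: l {hl} => a b; rewrite normc_def /= ltcE /=.
  move=> /andP[_ h].
  have : `|a| < 1.
    apply: le_lt_trans h; rewrite -sqrtr_sqr ler_sqrt ?lerDl ?sqr_ge0//.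
    by rewrite addr_ge0// sqr_ge0.
  by rewrite ltr_norml => /andP[].
have pos s : 0 < 1 + clamp s * complex.Re l.
  have /andP[c0 c1] := clamp_itv s.
  have [->|cn] := eqVneq (clamp s) 0; first by rewrite mul0r addr0.
  have : 0 < clamp s * (1 + complex.Re l) by rewrite mulr_gt0 ?lt0r ?cn//; lra.
  by lra.
pose u s := (clamp s * complex.Im l) / (1 + clamp s * complex.Re l).
have cu : continuous (fun s => atan (u s)).
  move=> s; apply: (@continuous_cvg _ _ _ _ _ _ (@atan R)); first exact: continuous_atan.
  apply: cvgM; first by apply: cvgM; [exact: clamp_continuous | exact: cvg_cst].
  apply: cvgV; first by rewrite gt_eqF.
  apply: cvgD; first exact: cvg_cst.
  by apply: cvgM; [exact: clamp_continuous | exact: cvg_cst].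
have W : winding (fun s => 1 + s%:C%C * l) (atan (u 1)).
  exists (fun s => atan (u s)); split=> //.
    by rewrite /u clamp0 !mul0r atan0.
  move=> s Is; have E : 1 + s%:C%C * l = ((1 + s * complex.Re l) +i* (s * complex.Im l))%C.
    case: l {hl l1 pos u cu} => a b; apply/eqP; rewrite eq_complex /=.
    by rewrite !mul0r subr0 !addr0 add0r !eqxx.
  rewrite E /u clamp_id//.
  have := @phase_right_half R (((1 + s * complex.Re l) +i* (s * complex.Im l))%C).
  by apply; rewrite /=; have := pos s; rewrite clamp_id.
exists (atan (u 1) + v).
  by under eq_fun do rewrite big_cons; exact: windingM.
apply: le_trans (ler_normD _ _) _; rewrite /= -[(size ls).+1]add1n natrD mulrDl mul1r lerD//.
rewrite ler_norml; apply/andP; split; rewrite ltW//.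
  exact: atan_gtNpi2.
exact: atan_ltpi2.
Qed.

End Winding.

(** * Complex linear and antilinear parts of a symplectic matrix *)

Section ComplexMatrices.
Variable R : realType.
Local Notation C := R[i].

Lemma complex_mxM m n p (X Y : 'M[R]_(m, n)) (X' Y' : 'M[R]_(n, p)) :
  complex_mx X Y *m complex_mx X' Y' =
  complex_mx (X *m X' - Y *m Y') (X *m Y' + Y *m X').
Proof.
apply/matrixP => i j; rewrite !mxE.
have -> : \sum_k complex_mx X Y i k * complex_mx X' Y' k j =
    \sum_k ((X i k * X' k j - Y i k * Y' k j) +i* (X i k * Y' k j + Y i k * X' k j))%C.
  by apply: eq_bigr => k _; rewrite !mxE.
have sumC (a b : 'I_n -> R) : \sum_k (a k +i* b k)%C = ((\sum_k a k) +i* (\sum_k b k))%C.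
  apply/eqP; rewrite eq_complex /=.
  by rewrite !(raddf_sum (@complex.Re R)) !(raddf_sum (@complex.Im R)) /= !eqxx.
by rewrite sumC sumrB big_split.
Qed.

Lemma complex_mxD m n (X Y X' Y' : 'M[R]_(m, n)) :
  complex_mx X Y + complex_mx X' Y' = complex_mx (X + X') (Y + Y').
Proof. by apply/matrixP => i j; rewrite !mxE. Qed.

Lemma complex_mxN m n (X Y : 'M[R]_(m, n)) :
  - complex_mx X Y = complex_mx (- X) (- Y).
Proof. by apply/matrixP => i j; rewrite !mxE. Qed.

Lemma complex_mx1 n : complex_mx 1%:M 0 = 1%:M :> 'M[C]_n.
Proof. by apply/matrixP => i j; rewrite !mxE; case: (i == j). Qed.

Lemma complex_mx0 m n : complex_mx 0 0 = 0 :> 'M[C]_(m, n).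
Proof. by apply/matrixP => i j; rewrite !mxE. Qed.

Definition adjmx m n (M : 'M[C]_(m, n)) : 'M[C]_(n, m) := (map_mx Num.conj M)^T.

Lemma adjmxM m n p (M : 'M[C]_(m, n)) (N : 'M[C]_(n, p)) :
  adjmx (M *m N) = adjmx N *m adjmx M.
Proof. by rewrite /adjmx map_mxM trmx_mul. Qed.

Lemma adjmxK m n (M : 'M[C]_(m, n)) : adjmx (adjmx M) = M.
Proof. by apply/matrixP => i j; rewrite !mxE conjCK. Qed.

Lemma adj_complex_mx m n (X Y : 'M[R]_(m, n)) :
  adjmx (complex_mx X Y) = complex_mx X^T (- Y^T).
Proof. by apply/matrixP => i j; rewrite !mxE. Qed.

Definition hnorm n (v : 'rV[C]_n) : C := (v *m adjmx v) 0 0.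

Lemma hnormE n (v : 'rV[C]_n) : hnorm v = \sum_i `|v 0 i| ^+ 2.
Proof. by rewrite /hnorm mxE; apply: eq_bigr => i _; rewrite !mxE normCK. Qed.

Lemma hnorm_ge0 n (v : 'rV[C]_n) : 0 <= hnorm v.
Proof. by rewrite hnormE sumr_ge0// => i _; rewrite exprn_ge0. Qed.

Lemma hnorm_gt0 n (v : 'rV[C]_n) : v != 0 -> 0 < hnorm v.
Proof.
move=> v0; rewrite lt0r hnorm_ge0 andbT; apply: contra v0.
rewrite hnormE psumr_eq0 => [/allP h|i _]; last by rewrite exprn_ge0.
apply/eqP/rowP => i; rewrite mxE; apply/eqP.
by have := h i (mem_index_enum _); rewrite /= expf_eq0 normr_eq0.
Qed.

Lemma hnormZ n (a : C) (v : 'rV[C]_n) : hnorm (a *: v) = `|a| ^+ 2 * hnorm v.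
Proof.
rewrite !hnormE mulr_sumr; apply: eq_bigr => i _.
by rewrite mxE normrM exprMn.
Qed.

(** For [s <> 0], evaluate the characteristic polynomial at [- 1 / s]. *)
Lemma det1D_spectrum n (M : 'M[C]_n) : exists2 ls : seq C,
  size ls = n /\ (forall l, l \in ls -> exists2 v : 'rV[C]_n, v != 0 & v *m M = l *: v) &
  forall s, \det (1%:M + s *: M) = \prod_(l <- ls) (1 + s * l).
Proof.
have [ls E] := closed_field_poly_normal (char_poly M).
rewrite (monicP (char_poly_monic M)) scale1r in E.
have sz : size ls = n.
  by have := size_char_poly M; rewrite E size_prod_XsubC => -[].
exists ls.
  split=> // l ll; have : root (char_poly M) l by rewrite E root_prod_XsubC.
  by rewrite -eigenvalue_root_char => /eigenvalueP[v vM v0]; exists v.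
move=> s; have [->|s0] := eqVneq s 0.
  by rewrite scale0r addr0 det1 big1// => l _; rewrite mul0r addr0.
have -> : 1%:M + s *: M = (- s) *: ((- s^-1)%:M - M).
  by rewrite scalerBr scaleNr [- s *: M]scaleNr opprK scale_scalar_mx mulrN mulfV// raddfN opprK.
rewrite detZ; have -> : \det ((- s^-1)%:M - M) = (char_poly M).[- s^-1].
  rewrite /char_poly -horner_evalE -det_map_mx; congr (\det _).
  apply/matrixP => i j; rewrite !mxE rmorphB rmorphMn /= !horner_evalE.
  by rewrite hornerX hornerC.
rewrite E horner_prod -[n in _ ^+ n]sz; clear -s0.
elim: ls => [|l ls IH]; first by rewrite !big_nil mul1r.
rewrite !big_cons /= -IH hornerXsubC exprS; field.
by rewrite s0.
Qed.

Section Components.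
Variable n : nat.
Implicit Types M N : 'M[R]_(n + n).

(** Identifying [(x, y)] with [x + i y], the real matrix [M] acts as
[z |-> clin M * z + alin M * conj z]. *)
Definition clin M : 'M[C]_n := complex_mx (2^-1 *: (ulsubmx M + drsubmx M))
  (2^-1 *: (dlsubmx M - ursubmx M)).
Definition alin M : 'M[C]_n := complex_mx (2^-1 *: (ulsubmx M - drsubmx M))
  (2^-1 *: (dlsubmx M + ursubmx M)).
(** The entrywise conjugate of [alin M]. *)
Definition alinc M : 'M[C]_n := complex_mx (2^-1 *: (ulsubmx M - drsubmx M))
  (- (2^-1 *: (dlsubmx M + ursubmx M))).

Let addE m p (A B : 'M[R]_(m, p)) i j : (A + B) i j = A i j + B i j. Proof. by rewrite mxE. Qed.
Let oppE m p (A : 'M[R]_(m, p)) i j : (- A) i j = - A i j. Proof. by rewrite mxE. Qed.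
Let scaE m p a (A : 'M[R]_(m, p)) i j : (a *: A) i j = a * A i j. Proof. by rewrite mxE. Qed.
Let zerE m p i j : (0 : 'M[R]_(m, p)) i j = 0. Proof. by rewrite mxE. Qed.
Let linE := (addE, oppE, scaE, zerE).

Local Notation expand := (mulmxDl, mulmxDr, mulNmx, mulmxN, opprD, opprK).

Let mulZZ m p q (a b : R) (A : 'M[R]_(m, p)) (B : 'M[R]_(p, q)) :
  (a *: A) *m (b *: B) = (a * b) *: (A *m B).
Proof. by rewrite -scalemxAl -scalemxAr scalerA. Qed.

Lemma clinM M N : clin (M *m N) = clin M *m clin N + alin M *m alinc N.
Proof.
rewrite /clin /alin /alinc !complex_mxM complex_mxD !(mulNmx, mulmxN) !mulZZ.
rewrite -[M]submxK -[N]submxK mulmx_block.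
rewrite !block_mxKul !block_mxKur !block_mxKdl !block_mxKdr.
rewrite !expand.
by congr complex_mx; apply/matrixP => i j; rewrite !linE; field.
Qed.

Lemma symplectic_relations M : symplectic M ->
  let A := ulsubmx M in let B := ursubmx M in
  let C := dlsubmx M in let D := drsubmx M in
  [/\ forall i j, (A *m B^T) i j = (B *m A^T) i j,
      forall i j, (C *m D^T) i j = (D *m C^T) i j,
      forall i j, (A *m D^T) i j - (B *m C^T) i j = 1%:M i j &
      forall i j, (D *m A^T) i j - (C *m B^T) i j = 1%:M i j].
Proof.
rewrite -{1}[M]submxK => /symplectic_blockP[h1 h2 h3] A B C D; split=> i j.
- by rewrite h1.
- by rewrite h2.
- by rewrite -h3 !linE.
- by rewrite -[1%:M]trmx1 -h3 linearB /= !trmx_mul !trmxK !linE.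
Qed.

Lemma symplectic_relationsT M : symplectic M ->
  let A := ulsubmx M in let B := ursubmx M in
  let C := dlsubmx M in let D := drsubmx M in
  [/\ forall i j, (A^T *m C) i j = (C^T *m A) i j,
      forall i j, (B^T *m D) i j = (D^T *m B) i j,
      forall i j, (A^T *m D) i j - (C^T *m B) i j = 1%:M i j &
      forall i j, (D^T *m A) i j - (B^T *m C) i j = 1%:M i j].
Proof.
rewrite -{1}[M]submxK => /symplectic_blockTP[h1 h2 h3] A B C D; split=> i j.
- by rewrite h1.
- by rewrite h2.
- by rewrite -h3 !linE.
- by rewrite -[1%:M]trmx1 -h3 linearB /= !trmx_mul !trmxK !linE.
Qed.

Let trE m p (a : R) (A B : 'M[R]_(m, p)) : (a *: (A + B))^T = a *: (A^T + B^T) /\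
  (a *: (A - B))^T = a *: (A^T - B^T).
Proof. by split; apply/matrixP => i j; rewrite !mxE. Qed.

Let tr_complex_mx (X Y : 'M[R]_n) : (complex_mx X Y)^T = complex_mx X^T Y^T.
Proof. by apply/matrixP => i j; rewrite !mxE. Qed.

Lemma clin_alin_row M : symplectic M ->
  clin M *m adjmx (clin M) - alin M *m adjmx (alin M) = 1%:M.
Proof.
move=> /symplectic_relations[h1 h2 h3 h4].
rewrite /clin /alin !adj_complex_mx !complex_mxM complex_mxN complex_mxD.
rewrite !(trE _ _ _).2 !(trE _ _ _).1.
rewrite !(mulNmx, mulmxN) !mulZZ -complex_mx1 !expand.
congr complex_mx; apply/matrixP => i j; rewrite !linE.
  by have := h3 i j; have := h4 i j; lra.
by have := h1 i j; have := h2 i j; lra.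
Qed.

Lemma clin_alin_col M : symplectic M ->
  (clin M)^T *m adjmx (clin M)^T - adjmx (alin M) *m alin M = 1%:M.
Proof.
move=> /symplectic_relationsT[h1 h2 h3 h4].
rewrite /clin /alin !tr_complex_mx !adj_complex_mx !trmxK !complex_mxM complex_mxN complex_mxD.
rewrite !(trE _ _ _).2 !(trE _ _ _).1.
rewrite !(mulNmx, mulmxN) !mulZZ -complex_mx1 !expand.
congr complex_mx; apply/matrixP => i j; rewrite !linE.
  by have := h3 i j; have := h4 i j; lra.
by have := h1 i j; have := h2 i j; lra.
Qed.

Lemma clin_alin_mixed M : symplectic M ->
  (clin M)^T *m alinc M = adjmx (alin M) *m clin M.
Proof.
move=> /symplectic_relationsT[h1 h2 h3 h4].
rewrite /clin /alin /alinc !tr_complex_mx !adj_complex_mx !complex_mxM.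
rewrite !(trE _ _ _).2 !(trE _ _ _).1.
rewrite !(mulNmx, mulmxN) !mulZZ !expand.
congr complex_mx; apply/matrixP => i j; rewrite !linE.
  by have := h1 i j; have := h2 i j; have := h3 i j; have := h4 i j; lra.
by have := h1 i j; have := h2 i j; have := h3 i j; have := h4 i j; lra.
Qed.

Lemma clin_unit M : symplectic M -> clin M \in unitmx.
Proof.
move=> hM; rewrite -row_free_unit -kermx_eq0; apply/negPn/negP => K0.
have v0 : nz_row (kermx (clin M)) != 0 by rewrite nz_row_eq0.
set v := nz_row _ in v0; have /sub_kermxP vK : (v <= kermx (clin M))%MS by exact: nz_row_sub.
have := hnorm_gt0 v0; have := hnorm_ge0 (v *m alin M).
have := clin_alin_row hM => /(congr1 (fun X => (v *m X *m adjmx v) 0 0)).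
rewrite mulmxBr mulmxBl !mulmxA vK !mul0mx sub0r mulmx1 /hnorm adjmxM !mulmxA [LHS]mxE.
by move=> <-; rewrite oppr_gt0 => h1 /lt_le_trans/(_ h1); rewrite ltxx.
Qed.

(** The matrix is the product of [invmx (clin M) * alin M], which strictly shortens row
vectors by [clin_alin_row], and of [alinc N * invmx (clin N)], which does not lengthen
them: by [clin_alin_mixed] it is also [invmx (clin N)^T * adjmx (alin N)], to which
[clin_alin_col] applies. *)
Lemma transfer_spectrum M N (v : 'rV[C]_n) (l : C) : symplectic M -> symplectic N ->
  v != 0 ->
  v *m (invmx (clin M) *m (alin M *m alinc N) *m invmx (clin N)) = l *: v -> `|l| < 1.
Proof.
move=> hM hN v0; have uM := clin_unit hM; have uN := clin_unit hN.
pose u := v *m invmx (clin M); pose y := u *m alin M.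
have uv : u *m clin M = v by rewrite /u mulmxKV.
have u0 : u != 0.
  by apply: contra v0 => /eqP u0; rewrite -uv u0 mul0mx.
have gap p (w : 'rV[C]_n) (P Q : 'M[C]_(n, p)) :
    P *m adjmx P - Q *m adjmx Q = 1%:M -> hnorm (w *m P) - hnorm (w *m Q) = hnorm w.
  move=> PQ; rewrite /hnorm !adjmxM !mulmxA -[X in _ = (X *m _) 0 0]mulmx1 -PQ.
  by rewrite mulmxBr mulmxBl !mulmxA [RHS]mxE [X in _ = _ + X]mxE.
have yv : hnorm y < hnorm v.
  by rewrite -subr_gt0 -uv (gap _ _ _ _ (clin_alin_row hM)) hnorm_gt0.
pose r := y *m invmx (clin N)^T.
have ry : r *m (clin N)^T = y by rewrite /r mulmxKV ?unitmx_tr.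
have mixed : alinc N *m invmx (clin N) = invmx (clin N)^T *m adjmx (alin N).
  apply: (can_inj (mulKmx (_ : (clin N)^T \in unitmx))); first by rewrite unitmx_tr.
  by rewrite mulmxA clin_alin_mixed// mulmxK// mulKVmx ?unitmx_tr.
rewrite !mulmxA -/u -/y -mulmxA mixed mulmxA -/r => E.
have : hnorm (l *: v) <= hnorm y.
  rewrite -subr_ge0 -E -ry (gap _ _ _ _ _) ?hnorm_ge0//.
  by rewrite adjmxK clin_alin_col.
move=> /le_lt_trans/(_ yv); rewrite hnormZ gtr_pMl ?hnorm_gt0//.
by rewrite expr_lt1.
Qed.

End Components.

End ComplexMatrices.

(** * Existence *)

Section Existence.
Variables (R : realType) (n : nat).
Local Opaque smooth.
Local Notation C := R[i].
Local Notation mx := 'M[R]_(n + n).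
Implicit Types (F G : R -> mx).

(** An angle in radians, unlike [turns] below. *)
Definition rotation F (w : R) := winding (fun t => \det (clin (F t))) w.

Section Continuity.
Variables (T : topologicalType) (M : T -> mx).
Hypothesis cM : continuous M.

Let entry i j : continuous (fun x => M x i j).
Proof.
by move=> x; exact: (cvg_comp _ _ (@cM x) (@coord_continuous R _ _ i j (M x))).
Qed.

Lemma clin_continuous : ccontinuous_mx (fun x => clin (M x)).
Proof.
move=> i j; split=> x; under eq_fun do rewrite !mxE /=; apply: cvgM; try exact: cvg_cst.
  by apply: cvgD; exact: entry.
by apply: cvgB; exact: entry.
Qed.

Lemma alin_continuous : ccontinuous_mx (fun x => alin (M x)).
Proof.
move=> i j; split=> x; under eq_fun do rewrite !mxE /=; apply: cvgM; try exact: cvg_cst.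
  by apply: cvgB; exact: entry.
by apply: cvgD; exact: entry.
Qed.

Lemma alinc_continuous : ccontinuous_mx (fun x => alinc (M x)).
Proof.
move=> i j; split=> x; under eq_fun do rewrite !mxE /=.
  by apply: cvgM; [exact: cvg_cst | apply: cvgB; exact: entry].
by apply: cvgN; apply: cvgM; [exact: cvg_cst | apply: cvgD; exact: entry].
Qed.

End Continuity.

Lemma det_clin_neq0 (M : mx) : symplectic M -> \det (clin M) != 0.
Proof. by move=> /clin_unit; rewrite unitmxE unitfE. Qed.

Lemma half_double (X : 'M[R]_n) : 2^-1 *: (X + X) = X.
Proof. by apply/matrixP => i j; rewrite !mxE; field. Qed.

Lemma clin1 : clin (1%:M : mx) = 1%:M.
Proof.
rewrite /clin scalar_mx_block block_mxKul block_mxKur block_mxKdl block_mxKdr.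
rewrite subrr scaler0 -complex_mx1; by rewrite half_double.
Qed.

Lemma curve_continuous F : sp_curve F -> continuous F.
Proof. by case=> sF _ _; exact: smooth_continuous. Qed.

Lemma rotation_exists F : sp_curve F -> exists w, rotation F w.
Proof.
move=> hF; have [_ aF F0] := hF; apply: winding_exists.
- by apply: ccontinuous_det; apply: clin_continuous; exact: curve_continuous.
- by move=> t; exact: det_clin_neq0.
- by rewrite F0 clin1 det1.
Qed.

(** The homotopy is constant at times 0 and 1, so these two sides of the square do not
contribute. *)
Lemma rotation_homotopy F G w v : sp_curve F -> sp_curve G ->
  curve_class F = curve_class G -> rotation F w -> rotation G v -> w = v.
Proof.
move=> hF hG; rewrite -(@curve_classE _ _ (curve_path hF) F)//.
rewrite -(@curve_classE _ _ (curve_path hG) G)//.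
move=> /path_classP[H [cH aH H0 Hs]] WF WG.
have I (t : R) : 0 <= t <= 1 -> t \in `[0, 1] by rewrite in_itv.
have Ic (t : R) : clamp t \in `[0, 1] by apply: I; exact: clamp_itv.
have cH' : continuous (H \o @clamp2 R).
  move=> x; move: cH => /subspace_continuousP cH.
  have Kx : (`[0, 1] `*` `[0, 1])%classic (clamp2 x) by split; exact: Ic.
  move=> U /(cH _ Kx) /(@clamp2_continuous R x).
  rewrite /within /= !nbhs_simpl /=; apply: filterS => y; apply.
  by split; exact: Ic.
have := @winding_square R (fun x => \det (clin ((H \o @clamp2 R) x))) (fun=> 1) w v 0.
rewrite addr0 => h; apply/esym; apply: h; last exact: winding1.
- by apply: ccontinuous_det; exact: clin_continuous.
- by move=> s t _ _; apply: det_clin_neq0; apply: aH; exact: Ic.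
- by move=> s _; rewrite /= /clamp2 /= clamp0 (Hs _ (Ic s)).1 clin1 det1.
- apply: winding_eq WF => t It /=.
  by rewrite /clamp2 /= clamp0 clamp_id// (H0 t (I _ It)).1.
- apply: winding_eq WG => t It /=.
  by rewrite /clamp2 /= clamp1 clamp_id// (H0 t (I _ It)).2.
- move=> s _; rewrite mulr1 /= /clamp2 /= clamp0 clamp1.
  by rewrite (Hs _ (Ic s)).2 (Hs 0 (I _ _)).2 ?lexx ?ler01.
Qed.

(** The square [K] interpolates between [clin (F t) * clin (G t)] and [clin (F t * G t)];
its side at time 1 carries the whole error, a product of [n] linear factors in the right
half-plane. *)
Lemma rotation_mul F G w v : sp_curve F -> sp_curve G ->
  rotation F w -> rotation G v -> exists u,
  [/\ rotation (fun t => F t *m G t) u, `|u - w - v| <= n%:R * (pi / 2) &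
      alinc (G 1) = 0 -> u = w + v].
Proof.
move=> hF hG WF WG; have [[_ aF F0] [_ aG G0]] := (hF, hG).
have [u Wu] := rotation_exists (sp_curveM hF hG); exists u.
pose M t := invmx (clin (F t)) *m (alin (F t) *m alinc (G t)) *m invmx (clin (G t)).
pose K (x : R * R) := \det (clin (F x.2) *m clin (G x.2) +
  x.1%:C%C *: (alin (F x.2) *m alinc (G x.2))).
have KE s t : K (s, t) = \det (clin (F t)) * \det (clin (G t)) * \det (1%:M + s%:C%C *: M t).
  rewrite /K /= mulrAC -!det_mulmx; congr (\det _).
  rewrite mulmxDr mulmx1 mulmxDl; congr (_ + _).
  rewrite -scalemxAr -scalemxAl /M !mulmxA mulmxV ?clin_unit// mul1mx.
  by rewrite -!mulmxA mulVmx ?clin_unit// mulmx1.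
have cK : ccontinuous K.
  have c2 (N : R -> mx) : continuous N -> continuous (fun x : R * R => N x.2).
    by move=> cN x; exact: (cvg_comp _ _ (@cvg_snd _ _ (nbhs x.1) (nbhs x.2) _) (cN x.2)).
  have cF := c2 _ (curve_continuous hF); have cG := c2 _ (curve_continuous hG).
  apply: ccontinuous_det => i j; under eq_fun do rewrite mxE.
  apply: ccontinuousD.
    exact: (ccontinuous_mulmx (clin_continuous cF) (clin_continuous cG)).
  under eq_fun do rewrite mxE; apply: ccontinuousM.
    by split=> x /=; [exact: cvg_fst | exact: cvg_cst].
  exact: (ccontinuous_mulmx (alin_continuous cF) (alinc_continuous cG)).
have spec t : exists2 ls : seq C, size ls = n /\ (forall l, l \in ls -> `|l| < 1) &
    forall s, \det (1%:M + s *: M t) = \prod_(l <- ls) (1 + s * l).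
  have [ls [sz ev] E] := det1D_spectrum (M t); exists ls => //; split=> // l /ev[x x0 xM].
  exact: (transfer_spectrum (aF t) (aG t) x0 xM).
have Kn s t : 0 <= s <= 1 -> 0 <= t <= 1 -> K (s, t) != 0.
  move=> Is _; rewrite KE !mulf_neq0 ?det_clin_neq0//.
  have [ls [_ ev] ->] := spec t.
  have [x [th [_ _ _ pth]] _] := winding_prod_unit_disk ev.
  exact: phase_neq0 (pth s Is).
have K0 s : 0 <= s <= 1 -> K (s, 0) = 1.
  move=> _; rewrite /K /= F0 G0 clin1 mulmx1.
  have -> : alinc (1%:M : mx) = 0.
    rewrite /alinc scalar_mx_block block_mxKul block_mxKur block_mxKdl block_mxKdr.
    by rewrite subrr addr0 !scaler0 oppr0 complex_mx0.
  by rewrite mulmx0 scaler0 addr0 det1.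
have W0 : winding (fun t => K (0, t)) (w + v).
  apply: winding_eq (windingM WF WG) => t _.
  by rewrite KE scale0r addr0 det1 mulr1.
have W1 : winding (fun t => K (1, t)) u.
  by apply: winding_eq Wu => t _; rewrite clinM /K /= scale1r.
have side s : 0 <= s <= 1 -> K (s, 1) = K (0, 1) * \det (1%:M + s%:C%C *: M 1).
  by move=> _; rewrite !KE scale0r addr0 det1 mulr1.
split=> //.
  have [ls [sz ev] E] := spec 1.
  have [x Wx xb] := winding_prod_unit_disk ev.
  have Wg : winding (fun s => \det (1%:M + s%:C%C *: M 1)) x.
    by under eq_fun do rewrite E.
  rewrite (winding_square cK Kn K0 W0 W1 side Wg).
  by rewrite -addrA -opprD addrAC subrr add0r -sz.
move=> G1; have M1 : M 1 = 0 by rewrite /M G1 !mulmx0 mul0mx.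
have Wg : winding (fun s => \det (1%:M + s%:C%C *: M 1)) 0.
  by under eq_fun do rewrite M1 scaler0 addr0 det1; exact: winding1.
by rewrite (winding_square cK Kn K0 W0 W1 side Wg) addr0.
Qed.

Lemma alin_orthogonal (M : mx) : symplectic M -> orthogonal_mx M ->
  [/\ alin M = 0, alinc M = 0 & clin M = complex_mx (ulsubmx M) (dlsubmx M)].
Proof.
move=> aM oM; have E := symplectic_orthogonal_block aM oM.
have [h1 h2] : ursubmx M = - dlsubmx M /\ drsubmx M = ulsubmx M.
  by split; rewrite [in LHS]E ?block_mxKur ?block_mxKdr.
rewrite /alin /alinc /clin h1 h2 !subrr opprK !scaler0 oppr0 complex_mx0; split=> //.
by rewrite !half_double.
Qed.

Lemma rotation_pow F w k : sp_curve F -> orthogonal_mx (F 1) -> rotation F w ->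
  rotation (fun t => mx_pow (F t) k) (k%:R * w).
Proof.
move=> hF oF WF; elim: k => [|k IH].
  rewrite mul0r /rotation; under eq_fun do rewrite clin1 det1.
  exact: winding1.
have hk := sp_curveX k hF.
have [u [Wu _ uE]] := rotation_mul hF hk WF IH.
rewrite -natr1 mulrDl mul1r addrC -uE//.
by case: (@alin_orthogonal (mx_pow (F 1) k)) => //; [case: hk | exact: orthogonal_pow].
Qed.

(** [xget] picks the rotation of some representing curve; it is the same for all of them by
[rotation_homotopy]. *)
Definition turns (g : SpTilde R n) : R :=
  xget 0 [set w | exists2 F, sp_curve F & g = curve_class F /\ rotation F w] / (2 * pi).

Lemma turnsE F w : sp_curve F -> rotation F w -> turns (curve_class F) = w / (2 * pi).
Proof.
move=> hF WF; rewrite /turns; case: xgetP => [v _ [G hG [GE WG]]|/(_ w)[]].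
  by rewrite (rotation_homotopy hF hG GE WF WG).
by exists F.
Qed.

Lemma turns_quasimorphism : quasimorphism turns.
Proof.
have p2 : 0 < 2 * pi :> R by rewrite mulr_gt0// pi_gt0.
exists (n%:R * (pi / 2) / (2 * pi)) => g h.
have [F hF ->] := curve_class_surj g; have [G hG ->] := curve_class_surj h.
have [w WF] := rotation_exists hF; have [v WG] := rotation_exists hG.
have [u [Wu ub _]] := rotation_mul hF hG WF WG.
rewrite -curve_classM// (turnsE (sp_curveM hF hG) Wu) (turnsE hF WF) (turnsE hG WG).
by rewrite -!mulrBl normrM [`|_^-1|]gtr0_norm ?invr_gt0// ler_pM2r ?invr_gt0.
Qed.

Lemma turns_pow F k : sp_curve F -> orthogonal_mx (F 1) ->
  turns (curve_class F ^+ k)%g = k%:R * turns (curve_class F).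
Proof.
move=> hF oF; have [w WF] := rotation_exists hF.
rewrite -curve_classX// (turnsE (sp_curveX k hF) (rotation_pow k hF oF WF)).
by rewrite (turnsE hF WF) mulrA.
Qed.

(** The determinant of a unitary matrix has modulus 1, so its phase determines it. *)
Lemma unitary_det (M : mx) a : symplectic M -> orthogonal_mx M ->
  phase (\det (clin M)) a -> \det (clin M) = (cos a +i* sin a)%C.
Proof.
move=> aM oM [m m0 E]; have [al _ _] := alin_orthogonal aM oM.
have := clin_alin_row aM; rewrite al mul0mx subr0 => /(congr1 determinant).
rewrite det_mulmx det1 /adjmx det_tr det_map_mx /= E -normCK normrM.
rewrite !normc_def /= cos2Dsin2 sqrtr1 expr0n addr0 sqrtr_sqr gtr0_norm// mulr1.
rewrite -rmorphXn /= => -[/eqP]; rewrite sqrf_eq1 => /orP[/eqP ->|/eqP mN]; first by rewrite mul1r.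
by move: m0; rewrite mN oppr_gt0 ltr10.
Qed.

Lemma descending_quasimorphism_exists : exists mu : SpTilde R n -> R,
  [/\ quasimorphism mu, homogeneous mu & descends_to_det mu].
Proof.
have [mu [qmu hmu muE]] := homogenization turns_quasimorphism.
exists mu; split=> // Psi X Y aP oP PE.
have [F hF [-> F1]] := path_class_curve_surj Psi; rewrite -F1 in aP oP PE.
rewrite muE => [|k]; last exact: turns_pow.
have [w WF] := rotation_exists hF.
have [_ _ cE] := alin_orthogonal aP oP.
rewrite (turnsE hF WF) cexp_turns mulrCA mulfV ?mulr1; last first.
  by rewrite mulf_neq0 ?pnatr_eq0// gt_eqF// pi_gt0.
rewrite -(unitary_det aP oP (winding_endpoint WF)) cE PE.
by rewrite block_mxKul block_mxKdl.
Qed.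

End Existence.

Theorem theorem1 (R : realType) (n : nat) (hn : (1 <= n)%N) :
  exists! mu : SpTilde R n -> R,
    [/\ quasimorphism mu, homogeneous mu & descends_to_det mu].
Proof.
have [mu hmu] := descending_quasimorphism_exists R n.
by exists mu; split=> // nu; exact: descending_quasimorphism_unique.
Qed.
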